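(* Let $\Omega\subset\mathbb{R}^3$ be an open bounded domain with $C^{1,1}$ boundary, let $e\in\mathbb{R}^3$ be a fixed (known) unit vector, and let $\mathbf{C}^0$ be the homogeneous isotropic elastic tensor $$C^0_{ijkl}=\lambda^0\delta_{ij}\delta_{kl}+\mu^0(\delta_{ik}\delta_{jl}+\delta_{il}\delta_{jk}),$$ where the constants $\lambda^0,\mu^0\in\mathbb{R}$ satisfy $\mu^0>0$ and $3\lambda^0+2\mu^0>0$. Let $\delta\mathbf{C}=(\delta C_{ijkl})$ have components in $L^\infty(\Omega)$ and be transversely isotropic with axis of symmetry $e$. If $\dot{\Lambda}_{\mathbf{C}^0}(\delta\mathbf{C})=0$, then $\delta\mathbf{C}=0$ (almost everywhere in $\Omega$).
   Context: Repeated indices are summed over $\{1,2,3\}$ and $\delta_{ij}$ is the Kronecker delta. An elastic perturbation $\delta\mathbf{C}=(\delta C_{ijkl})_{1\le i,j,k,l\le 3}$ is a real-valued tensor field on $\Omega$ with components in $L^\infty(\Omega)$ satisfying the symmetries $\delta C_{ijkl}=\delta C_{jikl}=\delta C_{klij}$. Transverse isotropy. Let $\mathcal{Q}$ be the set of $3\times 3$ matrices consisting of the three reflections $\mathrm{diag}(-1,1,1)$, $\mathrm{diag}(1,-1,1)$, $\mathrm{diag}(1,1,-1)$ and all rotations $$\begin{pmatrix}\cos\theta&-\sin\theta&0\\ \sin\theta&\cos\theta&0\\0&0&1\end{pmatrix},\qquad 0\le\theta\le 2\pi .$$ $\delta\mathbf{C}$ is transversely isotropic with axis of symmetry $x_3$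 (that is, $e=e_3=(0,0,1)$) if for almost every $x\in\Omega$ and every $Q\in\mathcal{Q}$, $$Q_{ip}Q_{jq}Q_{kr}Q_{ls}\,\delta C_{pqrs}(x)=\delta C_{ijkl}(x).$$ For a general unit vector $e$ (the same at every point $x$), $\delta\mathbf{C}$ is transversely isotropic with axis of symmetry $e$ if the same identity holds for almost every $x\in\Omega$ and all matrices $RQR^T$ (in place of $Q$) with $Q\in\mathcal{Q}$, where $R$ is a fixed rotation with $Re_3=e$ (the condition does not depend on the choice of $R$). Linearized Dirichlet-to-Neumann map at zero frequency. $\dot{\Lambda}_{\mathbf{C}^0}$ is the Fréchet derivative at $\mathbf{C}^0$ of the map $\mathbf{C}\mapsto\Lambda_{\mathbf{C}}$, where $\Lambda_{\mathbf{C}}f=\left(C_{ijkl}\nu_j\partial_k u^f_l|_{\partial\Omega}\right)_{i}$, $\nu$ is the outer unit normal, and $u^f\in H^1(\Omega)$ solves $\partial_j (C_{ijkl}\partial_k u^f_l)=0$ in $\Omega$ for $i=1,2,3$, with $u^f|_{\partial\Omega}=f$. The operator $\dot{\Lambda}_{\mathbf{C}^0}(\delta\mathbf{C}):H^{1/2}(\partial\Omega)\to H^{-1/2}(\partial\Omega)$ (on vector-valued functions with three components) is the bounded linear operator characterized by $$\langle\dot{\Lambda}_{\mathbf{C}^0}(\delta\mathbf{C})f,g\rangle=\int_\Omega\delta C_{ijkl}(x)\,\partial_iu_j(x)\,\partial_kv_l(x)\,dx\qquad\text{for all } f,g\in H^{1/2}(\partial\Omega),$$ where the pairing is bilinear (no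 complex conjugation) and $u,v\in H^1(\Omega)$ are the unique solutions of $$\mu^0\Delta u+(\lambda^0+\mu^0)\nabla(\nabla\cdot u)=0\ \text{in }\Omega,\quad u|_{\partial\Omega}=f;\qquad \mu^0\Delta v+(\lambda^0+\mu^0)\nabla(\nabla\cdot v)=0\ \text{in }\Omega,\quad v|_{\partial\Omega}=g.$$ *)

(* Defs.v *)
From HB Require Import structures.
From mathcomp Require Import all_boot all_order all_algebra.
From mathcomp Require Import complex.
From mathcomp Require Import all_classical all_reals all_analysis.

Set Implicit Arguments.
Unset Strict Implicit.
Unset Printing Implicit Defensive.

Import Order.TTheory GRing.Theory Num.Theory.
Import numFieldNormedType.Exports.

Local Open Scope classical_set_scope.
Local Open Scope ring_scope.
Local Open Scope complex_scope.

(* R^3 is the product type R * R * R, whose library norm is the max norm; it is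
   only used for topology, boundedness and Lipschitz continuity.  Euclidean
   distances are measured by [edist].  [mspace3] is the same type seen as the
   product of three copies of the Borel measurable line. *)
Notation space3 R := (R * R * R)%type.
Notation mspace3 R :=
  (measurableTypeR R * measurableTypeR R * measurableTypeR R)%type.

Definition coords (R : realType) (x : space3 R) : 'cV[R]_3 :=
  \col_i [:: x.1.1; x.1.2; x.2]`_i.

Definition ebasis (R : realType) (k : 'I_3) : space3 R :=
  ((k == 0%N :> nat)%:R, (k == 1%N :> nat)%:R, (k == 2%N :> nat)%:R).

Definition edist (R : realType) (x y : space3 R) : R :=
  Num.sqrt (\sum_i (coords x i 0 - coords y i 0) ^+ 2).

Definition lebesgue3 (R : realType) : {measure set (mspace3 R) -> \bar R} :=
  ((@lebesgue_measure R \x @lebesgue_measure R) \x @lebesgue_measure R)%E.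

(* The two-dimensional Hausdorff outer measure, normalised so that it is the
   surface area on surfaces: the supremum over d > 0 of the outer measures
   generated by (pi / 4) diam(E)^2 on the Borel sets E with diam(E) <= d.
   Restricting the covers to Borel sets changes nothing, since a set and its
   closure have the same diameter. *)
Section hausdorff.
Variable R : realType.
Local Open Scope ereal_scope.

Definition ediam (E : set (space3 R)) : \bar R :=
  maxe 0 (ereal_sup [set (edist p.1 p.2)%:E | p in E `*` E]).

Definition hausdorff_gauge (d : R) (E : set (mspace3 R)) : \bar R :=
  if ediam E <= d%:E then (pi / 4)%:E * (ediam E * ediam E) else +oo.

Definition hausdorff2 (A : set (mspace3 R)) : \bar R :=
  ereal_sup [set mu_ext (hausdorff_gauge d) A | d in [set d : R | (0 < d)%R]].

Lemma ediam0 : ediam set0 = 0.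
Proof.
rewrite /ediam; apply/max_idPl.
by apply: ge_ereal_sup => y /= [p [] []].
Qed.

Lemma hausdorff_gauge0 d : (0 < d)%R -> hausdorff_gauge d set0 = 0.
Proof. by move=> d0; rewrite /hausdorff_gauge ediam0 lee_fin ltW// mul0e mule0. Qed.

Lemma hausdorff_gauge_ge0 d E : 0 <= hausdorff_gauge d E.
Proof.
rewrite /hausdorff_gauge; case: ifPn => // _.
by rewrite mule_ge0 ?mule_ge0 ?lee_fin ?divr_ge0 ?pi_ge0// /ediam le_max lexx.
Qed.

Lemma hausdorff2_ge0 A : 0 <= hausdorff2 A.
Proof.
apply: (le_trans (mu_ext_ge0 (hausdorff_gauge_ge0 1) A)).
by apply: ereal_sup_ubound; exists 1%R => //=.
Qed.

Lemma hausdorff20 : hausdorff2 set0 = 0.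
Proof.
apply/eqP; rewrite eq_le hausdorff2_ge0 andbT.
by apply: ge_ereal_sup => y /= [d d0 <-]; rewrite mu_ext0 ?hausdorff_gauge0//;
  exact: hausdorff_gauge_ge0.
Qed.

Lemma le_hausdorff2 : {homo hausdorff2 : A B / A `<=` B >-> A <= B}.
Proof.
move=> A B AB; apply: ge_ereal_sup => y /= [d d0 <-].
apply: (le_trans (le_mu_ext _ AB)).
by apply: ereal_sup_ubound; exists d.
Qed.

Lemma hausdorff2_sigma_subadditive : sigma_subadditive hausdorff2.
Proof.
move=> F; apply: ge_ereal_sup => y /= [d d0 <-].
apply: (le_trans (mu_ext_sigma_subadditive (hausdorff_gauge_ge0 d) F)).
apply: lee_nneseries => [i _ _|i _]; first exact/mu_ext_ge0/hausdorff_gauge_ge0.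
by apply: ereal_sup_ubound; exists d.
Qed.

HB.instance Definition _ := isOuterMeasure.Build R (mspace3 R) hausdorff2
  hausdorff20 hausdorff2_ge0 le_hausdorff2 hausdorff2_sigma_subadditive.

Definition hausdorff2_outer : {outer_measure set (mspace3 R) -> \bar R} :=
  hausdorff2.

(* Its restriction to the Caratheodory-measurable sets (which include the Borel
   sets) is a measure. *)
Definition surface :
    {measure set (caratheodory_type hausdorff2_outer) -> \bar R} :=
  (hausdorff2_outer : set (caratheodory_type hausdorff2_outer) -> \bar R).

End hausdorff.

Definition bnd (R : realType) (Omega : set (space3 R)) : set (space3 R) :=
  closure Omega `\` interior Omega.

(* C^{1,1} functions of two variables, with globally Lipschitz gradient. *)
Definition C11 (R : realType) (gamma : R * R -> R) : Prop :=
  (forall y, differentiable gamma y) /\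
  exists L : R, forall y z v : R * R,
    `|'D_v gamma y - 'D_v gamma z| <= L * `|y - z| * `|v|.

(* In suitable orthonormal coordinates, Omega is locally the region above the
   graph of a C^{1,1} function. *)
Definition C11_boundary (R : realType) (Omega : set (space3 R)) : Prop :=
  forall x0, bnd Omega x0 ->
    exists (O : 'M[R]_3) (gamma : R * R -> R),
      [/\ O^T *m O = 1%:M, C11 gamma &
          \forall x \near x0,
            let y := O *m coords x in
            Omega x <-> gamma (y 0 0, y 1 0) < y ord_max 0].

Section sobolev.
Variable R : realType.
Implicit Types (Omega : set (space3 R)) (phi w : space3 R -> R).
Implicit Types (G : 'I_3 -> space3 R -> R).

Definition pd (k : 'I_3) phi : space3 R -> R := fun x => 'D_(ebasis R k) phi x.

Definition iter_pd (s : seq 'I_3) phi : space3 R -> R := foldr pd phi s.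

Definition smooth phi : Prop :=
  forall s : seq 'I_3, continuous (iter_pd s phi) /\
    forall k x, derivable (iter_pd s phi) x (ebasis R k).

Definition test_function Omega phi : Prop :=
  smooth phi /\ exists K, [/\ compact K, K `<=` Omega &
                             forall x, ~ K x -> phi x = 0].

Definition inLp Omega (p : \bar R) w : Prop :=
  (w \_ Omega : mspace3 R -> R) \in Lfun (@lebesgue3 R) p.

Definition weak_pd Omega (k : 'I_3) w (g : space3 R -> R) : Prop :=
  forall phi, test_function Omega phi ->
    (\int[@lebesgue3 R]_(x in Omega) (w x * pd k phi x) =
     - \int[@lebesgue3 R]_(x in Omega) (g x * phi x))%R.

(* w is in H^1(Omega), with weak gradient G. *)
Definition sobolev1 Omega w G : Prop :=
  inLp Omega 2%:E w /\
  forall k, inLp Omega 2%:E (G k) /\ weak_pd Omega k w (G k).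

(* The trace of w (with weak gradient G) on the boundary is f: this is the
   extension by continuity, from H^1(Omega) to L^2 of the boundary, of the
   restriction of smooth functions.  Only the values of f on the boundary
   matter. *)
Definition trace Omega w G (f : space3 R -> R) : Prop :=
  measurable_fun (bnd Omega : set (mspace3 R)) (f : mspace3 R -> R) /\
  exists phi : nat -> space3 R -> R,
  [/\ forall n, smooth (phi n),
      'N[@lebesgue3 R]_2%:E[EFin \o ((phi n \- w)%R \_ Omega)]%E
        @[n --> \oo] --> 0%E,
      forall k,
        'N[@lebesgue3 R]_2%:E[EFin \o ((pd k (phi n) \- G k)%R \_ Omega)]%E
        @[n --> \oo] --> 0%E &
      'N[@surface R]_2%:E[EFin \o ((phi n \- f)%R \_ (bnd Omega))]%E
        @[n --> \oo] --> 0%E].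

End sobolev.

Section elasticity.
Variable R : realType.

(* Complex vector fields u = (u_j) on R^3, and their gradients
   Du i j = d_i u_j; on the boundary only the values there are relevant. *)
Definition vfield := 'I_3 -> space3 R -> R[i].
Definition vgrad := 'I_3 -> 'I_3 -> space3 R -> R[i].
Definition tensor_field := 'I_3 -> 'I_3 -> 'I_3 -> 'I_3 -> space3 R -> R.

Implicit Types (Omega : set (space3 R)) (u v f g : vfield) (Du Dv : vgrad).

Definition re (w : space3 R -> R[i]) : space3 R -> R := fun x => complex.Re (w x).
Definition im (w : space3 R -> R[i]) : space3 R -> R := fun x => complex.Im (w x).

Definition cintegral Omega (F : space3 R -> R[i]) : R[i] :=
  (\int[@lebesgue3 R]_(x in Omega) re F x)%R +i*
  (\int[@lebesgue3 R]_(x in Omega) im F x)%R.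

Definition H1 Omega u Du : Prop := forall j,
  sobolev1 Omega (re (u j)) (fun i => re (Du i j)) /\
  sobolev1 Omega (im (u j)) (fun i => im (Du i j)).

Definition vtrace Omega u Du f : Prop := forall j,
  trace Omega (re (u j)) (fun i => re (Du i j)) (re (f j)) /\
  trace Omega (im (u j)) (fun i => im (Du i j)) (im (f j)).

Definition H12 Omega f : Prop :=
  exists u Du, H1 Omega u Du /\ vtrace Omega u Du f.

(* mu Laplacian(u) + (lambda + mu) grad (div u) = 0 in the weak sense. *)
Definition lame_equation Omega (lambda mu : R) Du : Prop :=
  forall (phi : space3 R -> R) (i : 'I_3), test_function Omega phi ->
    cintegral Omega (fun x =>
      mu%:C * (\sum_k Du k i x * (pd k phi x)%:C) +
      (lambda + mu)%:C * ((\sum_k Du k k x) * (pd i phi x)%:C)) = 0.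

Definition lame_solution Omega (lambda mu : R) f u Du : Prop :=
  [/\ H1 Omega u Du, vtrace Omega u Du f & lame_equation Omega lambda mu Du].

Definition elastic_form Omega (dC : tensor_field) Du Dv : R[i] :=
  cintegral Omega (fun x => \sum_i \sum_j \sum_k \sum_l
    (dC i j k l x)%:C * Du i j x * Dv k l x).

(* L f g is the pairing < L f, g > of the linearized Dirichlet-to-Neumann map,
   at the homogeneous isotropic tensor with Lame constants lambda and mu, in the
   direction dC.  As the Dirichlet problem is uniquely solvable, this determines
   L on H^{1/2} data. *)
Definition linearized_DtN Omega (lambda mu : R) (dC : tensor_field)
    (L : vfield -> vfield -> R[i]) : Prop :=
  forall f g, H12 Omega f -> H12 Omega g ->
  forall u Du v Dv,
    lame_solution Omega lambda mu f u Du ->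
    lame_solution Omega lambda mu g v Dv ->
    L f g = elastic_form Omega dC Du Dv.

Definition elastic_perturbation Omega (dC : tensor_field) : Prop :=
  (forall i j k l, inLp Omega +oo%E (dC i j k l)) /\
  {ae @lebesgue3 R, forall x, Omega x -> forall i j k l,
     dC i j k l x = dC j i k l x /\ dC i j k l x = dC k l i j x}.

Definition rot3 (theta : R) : 'M[R]_3 :=
  \matrix_(i, j) (nth [::] [:: [:: cos theta; - sin theta; 0];
                               [:: sin theta; cos theta; 0];
                               [:: 0; 0; 1]] i)`_j.

Definition reflection (k : 'I_3) : 'M[R]_3 :=
  diag_mx (\row_j (if j == k then -1 else 1)).

Definition TI_group : set 'M[R]_3 :=
  [set Q | (exists k, Q = reflection k) \/
           exists theta, 0 <= theta <= 2 * pi /\ Q = rot3 theta].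

Definition tensor_invariant (Q : 'M[R]_3) (C : 'I_3 -> 'I_3 -> 'I_3 -> 'I_3 -> R) :=
  forall i j k l,
    \sum_p \sum_q \sum_r \sum_s Q i p * Q j q * Q k r * Q l s * C p q r s =
    C i j k l.

Definition transversely_isotropic Omega (e : 'cV[R]_3) (dC : tensor_field) : Prop :=
  exists T : 'M[R]_3, [/\ T^T *m T = 1%:M, \det T = 1,
    T *m delta_mx ord_max 0 = e &
    {ae @lebesgue3 R, forall x, Omega x -> forall Q, TI_group Q ->
       tensor_invariant (T *m Q *m T^T) (fun i j k l => dC i j k l x)}].

End elasticity.

(* Main.v *)
From HB Require Import structures.
Require Import Defs.
From mathcomp Require Import all_boot all_order all_algebra.
From mathcomp Require Import complex ring lra.
From mathcomp Require Import all_classical all_reals all_analysis.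
From mathcomp Require Import measurable_realfun ess_sup_inf.
Import Order.TTheory GRing.Theory Num.Theory.
Import numFieldNormedType.Exports.
Local Open Scope classical_set_scope.
Local Open Scope ring_scope.
Local Open Scope complex_scope.

Set Implicit Arguments.
Unset Strict Implicit.
Unset Printing Implicit Defensive.

(** The perturbation is determined because the Lame system has enough explicit
    exponential solutions.

    Orthogonality.  A smooth field on the whole space that solves the Lame system
    is its own weak solution and its own trace, so a vanishing linearized map says
    that the integral over [Omega] of [dC(grad u, grad v)] is zero for all smooth
    Lame fields [u] and [v] ([field_orthogonality]).  The only analytic input is
    integration by parts against test functions.

    Normal form.  In a frame whose third vector is the axis, invariance under the
    reflections, the quarter turn and one generic turn leaves five moduli, written
    [h12], [h66], [h13], [h33] and [h44] after the usual two-index labels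
    [C12], [C66], [C13], [C33] and [C44] ([TI_tensorP], [frame_TI_tensor]).

    Solutions.  Let [z = a + i b] be a complex vector with [z . z = 0], that is
    [|a| = |b|] and [a . b = 0].  The real and imaginary parts of [exp (z . x)] are
    harmonic.  Their gradients are divergence-free Lame fields, and fields of
    Papkovich type, with one factor linear in [x], are Lame fields whose divergence
    is a nonzero exponential.  Pairing the field of [z] with that of its conjugate,
    which for real fields means adding the contributions of the real and of the
    imaginary part, leaves the real weight [exp (2 a . x)].

    Elimination.  Put [X = |z_3|^2] and [Y = |z_1|^2 + |z_2|^2].  Two gradients give
      [(h12 - 2 h13 + h33) X^2 + 2 h66 Y^2 + 4 h44 X Y = 0]
    for the transforms with weight [exp (2 a . x)]
    ([gradient_energy_identity]).  If [a] is not along the axis, [X] takes several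
    values while [a] and [X + Y = 2 |a|^2] stay fixed, so the three coefficients
    vanish ([null_companion], [quadratic_form_line_eq0]).  The moduli left are
    [h12] and [h13], and they enter only through the divergence: a
    Papkovich field against a gradient kills [h13 - h12], and two Papkovich fields
    kill [h12] ([papkovich_gradient_identity], [papkovich_papkovich_identity]).

    Uniqueness.  Each elimination step gives a vanishing Laplace transform
    at all real frequencies of a half-space, chosen so as to avoid the axis.  This
    is enough to make an integrable function on a bounded set vanish
    ([laplace_injective]): products of indicators of rays are bounded limits of
    polynomials in exponentials. *)

(** * Lebesgue measure and continuous functions on space *)

Section measure3.
Variable R : realType.
Implicit Types (U Omega : set (space3 R)) (f g : space3 R -> R).
Local Notation mu3 := (@lebesgue3 R).

(** The topology of the product is that of the max norm, and its sigma-algebra is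
    generated by rectangles; rational boxes link the two. *)
Lemma open_measurable3 U : open U -> measurable (U : set (mspace3 R)).
Proof.
move=> oU.
pose box (i : (rat * rat * rat) * nat) : set (space3 R) :=
  (ball (ratr i.1.1.1 : R) (i.2.+1%:R^-1 : R) `*`
   ball (ratr i.1.1.2 : R) (i.2.+1%:R^-1 : R)) `*`
   ball (ratr i.1.2 : R) (i.2.+1%:R^-1 : R).
have -> : U = \bigcup_i (if `[< box i `<=` U >] then box i else set0).
  apply/seteqP; split => [x Ux|x [i _]]; last first.
    by case: asboolP => // + bx; exact.
  have /nbhs_ballP[e /= e0 eU] := open_nbhs_nbhs (conj oU Ux).
  have [n n0] : exists n : nat, n.+1%:R^-1 < e / 2.
    have e2 : 0 < e / 2 by rewrite divr_gt0.
    have [n _ H] := near_infty_natSinv_lt (PosNum e2).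
    by exists n; exact: (H n (leqnn n)).
  have d0 : 0 < n.+1%:R^-1 :> R by rewrite invr_gt0.
  have ex (t : R) : exists q : rat, `|ratr q - t| < n.+1%:R^-1.
    have [|q /itvP qP] := @rat_in_itvoo R t (t + n.+1%:R^-1); first by rewrite ltrDl.
    by exists q; rewrite ger0_norm ?subr_ge0 ?qP// ltrBlDl qP.
  have [q1 h1] := ex x.1.1; have [q2 h2] := ex x.1.2; have [q3 h3] := ex x.2.
  have sub (t q y : R) : `|q - t| < n.+1%:R^-1 -> ball q n.+1%:R^-1 y -> ball t e y.
    rewrite -!ball_normE /= => qt qy.
    rewrite -(subrK q t) -addrA; apply: (le_lt_trans (ler_normD _ _)).
    by rewrite distrC (splitr e) ltrD// (lt_trans _ n0).
  have sU : box (q1, q2, q3, n) `<=` U.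
    move=> [[y1 y2] y3] [[/= b1 b2] b3]; apply: eU.
    by split; first split; [exact: sub h1 _|exact: sub h2 _|exact: sub h3 _].
  exists (q1, q2, q3, n) => //; rewrite asboolT//=.
apply: countable_bigcupT_measurable => [|i]; first exact: countableP.
case: asboolP => // _.
by apply: measurableX; first apply: measurableX; apply: open_measurable; exact: ball_open.
Qed.

Lemma continuous_measurable3 f : continuous f ->
  measurable_fun setT (f : mspace3 R -> R).
Proof.
move=> cf; apply: (measurability _ (RGenOpens.measurableE R)).
move=> _ [_ [a [b ->]] <-]; rewrite setTI.
by apply: open_measurable3; move/continuousP : cf; apply; exact: interval_open.
Qed.

Definition box3 (M : R) : set (space3 R) :=
  (`[- M, M]%classic `*` `[- M, M]%classic) `*` `[- M, M]%classic.

Lemma compact_box3 M : compact (box3 M).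
Proof.
by apply: compact_setX; [apply: compact_setX|]; exact: segment_compact.
Qed.

Lemma measurable_box3 M : measurable (box3 M : set (mspace3 R)).
Proof.
by apply: measurableX; [apply: measurableX|]; exact: measurable_itv.
Qed.

Lemma lebesgue3_box3 M : (mu3 (box3 M) < +oo)%E.
Proof.
rewrite /box3; set I : set R := `[- M, M]%classic.
have mI : measurable I by exact: measurable_itv.
have h : (@lebesgue_measure R I < +oo)%E.
  by rewrite lebesgue_measure_itv /=; case: ifP => // _; rewrite ltry.
have E2 : ((@lebesgue_measure R \x @lebesgue_measure R) (I `*` I) =
    @lebesgue_measure R I * @lebesgue_measure R I)%E by exact: product_measure1E.
have E3 : (mu3 (I `*` I `*` I) =
    @lebesgue_measure R I * @lebesgue_measure R I * @lebesgue_measure R I)%E.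
  rewrite -E2; apply: product_measure1E => //; exact: measurableX.
rewrite E3 lte_mul_pinfty ?mule_ge0//.
by rewrite fin_numM// ge0_fin_numE.
Qed.

Lemma bounded_box3 U : bounded_set U -> exists2 M, 0 < M & U `<=` box3 M.
Proof.
move=> /pinfty_ex_gt0[M M0 UM]; exists M => // -[[x y] z] Uxyz.
have := UM _ Uxyz; rewrite /= !prod_normE /= !ge_max /= => /andP[/andP[hx hy] hz].
by do !split; rewrite /= in_itv /= -ler_norml.
Qed.

Lemma continuous_bounded3 f U : continuous f -> bounded_set U ->
  exists2 M, 0 < M & forall x, U x -> `|f x| <= M.
Proof.
move=> cf /bounded_box3[M _ UM].
have /pinfty_ex_gt0[N N0 h] : bounded_set (f @` box3 M).
  apply: compact_bounded; apply: continuous_compact; last exact: compact_box3.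
  exact: continuous_subspaceT.
by exists N => // x Ux; apply: h; exists x => //; exact: UM.
Qed.

Lemma continuous_integrable3 f U : measurable (U : set (mspace3 R)) ->
  bounded_set U -> continuous f -> mu3.-integrable (U : set (mspace3 R)) (EFin \o f).
Proof.
move=> mU bU cf; apply: measurable_bounded_integrable => //.
- have [M _ UM] := bounded_box3 bU.
  apply: le_lt_trans (lebesgue3_box3 M).
  by apply: le_measure => //; rewrite inE//; exact: measurable_box3.
- by apply: measurable_funTS; exact: continuous_measurable3.
- have [M M0 h] := continuous_bounded3 cf bU.
  by exists M; split=> [|N MN x Ux]; [exact: num_real|apply/(le_trans (h _ Ux))/ltW].
Qed.

Lemma continuous_inL2 f Omega : open Omega -> bounded_set Omega ->
  continuous f -> inLp Omega 2%:E f.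
Proof.
move=> oO bO cf; have mO := open_measurable3 oO.
rewrite /inLp; apply/andP; split; rewrite inE/=.
  apply/(measurable_restrictT _ _).1 => //.
  by apply: measurable_funTS; exact: continuous_measurable3.
rewrite /finite_norm unlock poweR_lty//.
have cf2 : continuous (fun x => f x * f x).
  by move=> x; apply: cvgM; exact: cf.
have /integrableP[_] := continuous_integrable3 mO bO cf2.
move=> H; apply: le_lt_trans H; rewrite [leRHS]integral_mkcond.
rewrite le_eqVlt; apply/orP; left; apply/eqP; apply: eq_integral => x _.
rewrite patchE /= patchE; case: ifPn => _; last by rewrite normr0 powR0.
by rewrite powR_mulrn// expr2 normrM.
Qed.
End measure3.

(** * Integration by parts against test functions *)

(** Fubini's theorem on the three-fold product requires a sigma-finite measure
    as its first factor; the name carries that structure. *)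
Definition lebesgue2 (R : realType) :
    set (measurableTypeR R * measurableTypeR R)%type -> \bar R :=
  (@lebesgue_measure R \x @lebesgue_measure R)%E.

HB.instance Definition _ (R : realType) := Measure.copy (@lebesgue2 R)
  (@lebesgue_measure R \x @lebesgue_measure R)%E.

Lemma sigma_finite_lebesgue2 (R : realType) : sigma_finite setT (@lebesgue2 R).
Proof.
exact: (isSigmaFinite.sigma_finiteT
  (lebesgue_integral_fubini.measure_function_Measure_isSigmaFinite__to__measure_function_isSigmaFinite
    (@lebesgue_measure R) (@lebesgue_measure R))).
Qed.

HB.instance Definition _ (R : realType) := Measure_isSigmaFinite.Build _ _ _
  (@lebesgue2 R) (@sigma_finite_lebesgue2 R).

Section weak_derivative.
Variable R : realType.
Implicit Types (Omega : set (space3 R)) (F G w phi : space3 R -> R).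
Local Notation mu3 := (@lebesgue3 R).
Local Notation mu1 := (@lebesgue_measure R).

Lemma integral_derive_compact (g g' : R -> R) (N : R) : 0 < N ->
  (forall t, is_derive t (1 : R) g (g' t)) -> continuous g' ->
  (forall t, N < `|t| -> g t = 0) -> (\int[mu1]_t (g' t)%:E = 0)%E.
Proof.
move=> N0 dg cg' g0.
have g'0 t : N < `|t| -> g' t = 0.
  move=> Nt; have [_ <-] := dg t.
  rewrite (@near_eq_derive _ _ _ g (cst 0)) ?derive_cst//.
  have : \forall s \near t, N < `|s|.
    by move: (@norm_continuous _ R^o t) => /cvgr_gt; apply.
  by apply: filterS => s; exact: g0.
pose I := `[- (N + 1), N + 1]%classic : set R.
transitivity (\int[mu1]_(t in I) (g' t)%:E)%E.
  rewrite [RHS]integral_mkcond; apply: eq_integral => t _.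
  rewrite patchE; case: ifPn => // tI; rewrite g'0// ltNge; apply: contra tI.
  rewrite ler_norml => /andP[h1 h2]; rewrite inE /I /= in_itv /=.
  by apply/andP; split; lra.
have cg : continuous g.
  by move=> t; apply/differentiable_continuous/derivable1_diffP; have [] := dg t.
rewrite (@continuous_FTC2 _ g' g).
- have N1 : N < `|N + 1| by rewrite ger0_norm; lra.
  by rewrite !g0 ?normrN// subee.
- by lra.
- exact: continuous_subspaceT.
- split.
  + by move=> t _; have [] := dg t.
  + exact/cvg_at_right_filter/cg.
  + exact/cvg_at_left_filter/cg.
- by move=> t _; rewrite derive1E; have [_ ->] := dg t.
Qed.

(** A directional derivative is an ordinary derivative along the line, which is
    what reduces the integrals below to one variable. *)
Lemma is_derive_line F (e x : space3 R) t :
  derivable F (t *: e + x) e ->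
  is_derive t (1 : R) (fun s => F (s *: e + x)) ('D_e F (t *: e + x)).
Proof.
move=> dF.
have E : (fun h : R => h^-1 *: (((fun s => F (s *: e + x)) \o shift t) (h *: (1 : R)) -
      F (t *: e + x))) =
   (fun h : R => h^-1 *: ((F \o shift (t *: e + x)) (h *: e) - F (t *: e + x))).
  apply/funext => h /=; congr (_ *: (F _ - _)).
  have -> : h *: (1 : R) = h by exact: mulr1.
  by rewrite scalerDl addrA.
split; last by rewrite /derive E.
by rewrite /derivable E.
Qed.

Lemma pd_eq0 F (K : set (space3 R)) k : closed K -> (forall x, ~ K x -> F x = 0) ->
  forall x, ~ K x -> pd k F x = 0.
Proof.
move=> cK F0 x Kx; rewrite /pd (@near_eq_derive _ _ _ F (cst 0)) ?derive_cst//.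
have : nbhs x (~` K) by apply: open_nbhs_nbhs; split=> //; exact: closed_openC.
by apply: filterS => y; exact: F0.
Qed.

Let set_coord (i : 'I_3) (x : space3 R) (t : R) : space3 R :=
  if i == 0 :> nat then (t, x.1.2, x.2) else
  if i == 1%N :> nat then (x.1.1, t, x.2) else (x.1.1, x.1.2, t).

Let integral_line F (N : R) k (x : space3 R) : 0 < N ->
  (forall y, derivable F y (ebasis R k)) -> continuous (pd k F) ->
  (forall y, ~ box3 N y -> F y = 0) ->
  (\int[mu1]_t (pd k F (set_coord k x t))%:E = 0)%E.
Proof.
move=> N0 dF cF F0.
have set_coordE t : set_coord k x t = t *: ebasis R k + set_coord k x 0.
  have lin (a b c u v w : R) : t *: ((a, b, c) : space3 R) + (u, v, w) =
    (t * a + u, t * b + v, t * c + w) by [].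
  rewrite /set_coord /ebasis; case: k {dF cF} => -[|[|[|//]]] ? /=;
  by rewrite lin !mulr0 !mulr1 !add0r ?addr0.
apply: (@integral_derive_compact (fun t => F (set_coord k x t)) _ N) => //.
- move=> t; rewrite (_ : (fun t => _) = fun s => F (s *: ebasis R k + set_coord k x 0)).
    by rewrite (set_coordE t); exact: is_derive_line.
  by apply/funext => s; rewrite set_coordE.
- have -> : (fun t => pd k F (set_coord k x t)) = pd k F \o (fun t => t *: ebasis R k + set_coord k x 0).
    by apply/funext => t /=; rewrite -set_coordE.
  move=> t; apply: continuous_comp; last exact: cF.
  apply: (@cvgD _ (space3 R : normedModType R)); last exact: cvg_cst.
  by apply: (@scalel_continuous R (space3 R : normedModType R) (ebasis R k) t).
- move=> t Nt; apply: F0; rewrite /set_coord /box3 => /=.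
  case: ifP => _; [|case: ifP => _]; rewrite /= !in_itv /= => -[[h1 h2] h3];
  by move: Nt; rewrite ltNge ler_norml ?h1 ?h2 ?h3.
Qed.

(** By Fubini the integral can be taken first along the [k]-th coordinate, where
    it is the integral of the derivative of a compactly supported function. *)
Lemma integral_pd_compact F (N : R) k : 0 < N ->
  (forall y, derivable F y (ebasis R k)) -> continuous (pd k F) ->
  (forall y, ~ box3 N y -> F y = 0) ->
  (\int[mu3]_x (pd k F x)%:E = 0)%E.
Proof.
move=> N0 dF cF F0.
have line x := integral_line x N0 dF cF F0.
pose H : mspace3 R -> \bar R := fun x => (pd k F x)%:E.
have cB : closed (box3 N) by apply: compact_closed; [exact: norm_hausdorff|exact: compact_box3].
have bB : bounded_set (box3 N) by apply: compact_bounded; exact: compact_box3.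
have iH : mu3.-integrable setT H.
  have -> : H = (EFin \o pd k F) \_ (box3 N : set (mspace3 R)); last first.
    apply/(integrable_mkcond _ (measurable_box3 N)).
    exact: continuous_integrable3 (measurable_box3 N) bB cF.
  apply/funext => x.
  rewrite patchE; case: ifPn => // /negP; rewrite inE => xB.
  by rewrite /H (pd_eq0 k cB F0).
(* The coordinates are grouped as a plane times a line: for the last coordinate
   one application of Fubini is enough, for the others it is used twice. *)
have [k2|k2] := eqVneq (k : nat) 2%N.
  refine (etrans (esym (@integral12_prod_meas1 _ _ _ _ R (@lebesgue2 R) mu1 H iH)) _).
  apply: integral0_eq => -[x y] _.
  by rewrite -[RHS](line ((x, y), 0)) /fubini_F /H /set_coord k2.
refine (etrans (esym (@integral21_prod_meas1 _ _ _ _ R (@lebesgue2 R) mu1 H iH)) _).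
transitivity (\int[mu1]_z (cst 0 z : \bar R))%E; last exact: integral0.
apply: ae_eq_integral => //; first exact: (@measurable_fubini_G _ _ _ _ R (@lebesgue2 R) mu1 H iH).
apply: filterS (@ae_integrable2 _ _ _ _ R (@lebesgue2 R) mu1 H iH) => z iz _; rewrite /fubini_G.
have [k0|k0] := eqVneq (k : nat) 0%N.
  refine (etrans (esym (integral21_prod_meas1 iz)) _); apply: integral0_eq => y _.
  by rewrite -[RHS](line ((0, y), z)) /fubini_G /H /set_coord k0.
refine (etrans (esym (integral12_prod_meas1 iz)) _); apply: integral0_eq => x _.
have k1 : (k : nat) = 1%N by case: k k0 k2 {dF cF line H iH iz} => -[|[|[|]]].
by rewrite -[RHS](line ((x, 0), z)) /fubini_F /H /set_coord k1.
Qed.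

Lemma smooth_continuous w : smooth w -> continuous w.
Proof. by move=> sw; have [] := sw [::]. Qed.

Lemma smooth_derivable w : smooth w -> forall k x, derivable w x (ebasis R k).
Proof. by move=> sw k x; have [_] := sw [::]; exact. Qed.

Lemma smooth_pd w k : smooth w -> smooth (pd k w).
Proof.
move=> sw s; have := sw (rcons s k).
by rewrite /iter_pd foldr_rcons.
Qed.

(** The product [w * phi] is supported in a compact subset of [Omega], so its
    partial derivative integrates to zero. *)
Lemma smooth_weak_pd Omega w k : open Omega -> bounded_set Omega -> smooth w ->
  weak_pd Omega k w (pd k w).
Proof.
move=> oO bO sw phi [sphi [K [cK KO phi0]]].
have mO := open_measurable3 oO.
have [N N0 ON] := bounded_box3 bO.
have cw := smooth_continuous sw; have cphi := smooth_continuous sphi.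
have cdw := smooth_continuous (smooth_pd k sw).
have cdphi := smooth_continuous (smooth_pd k sphi).
have dw x : derivable w x (ebasis R k) by exact: smooth_derivable.
have dphi x : derivable phi x (ebasis R k) by exact: smooth_derivable.
pose F x := w x * phi x.
have dF y : derivable F y (ebasis R k) by exact: derivableM.
have pdF : pd k F = fun x => w x * pd k phi x + pd k w x * phi x.
  apply/funext => x; rewrite /pd /F deriveM//.
  by rewrite /GRing.scale /= [X in _ + X]mulrC.
have c1 : continuous (fun x => w x * pd k phi x).
  by move=> x; apply: cvgM; [exact: cw|exact: cdphi].
have c2 : continuous (fun x => pd k w x * phi x).
  by move=> x; apply: cvgM; [exact: cdw|exact: cphi].
have cF : continuous (pd k F) by rewrite pdF => x; apply: cvgD; [exact: c1|exact: c2].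
have F0 y : ~ K y -> F y = 0 by move=> Ky; rewrite /F phi0// mulr0.
have F1 y : ~ box3 N y -> F y = 0 by move=> By; apply: F0 => /KO/ON.
have clK : closed K by apply: compact_closed => //; exact: norm_hausdorff.
have /(congr1 fine) /= := integral_pd_compact N0 dF cF F1.
have -> : (\int[mu3]_x (pd k F x)%:E = \int[mu3]_(x in Omega) (pd k F x)%:E)%E.
  rewrite [RHS]integral_mkcond; apply: eq_integral => x _.
  rewrite patchE; case: ifPn => // /negP; rewrite inE => xO.
  by rewrite (pd_eq0 k clK F0)// => /KO.
rewrite pdF -/(Rintegral _ _ _) RintegralD//; try exact: continuous_integrable3.
by move/eqP; rewrite addr_eq0 => /eqP.
Qed.
End weak_derivative.

(** * Smooth Lame fields as weak solutions *)

Section smooth_fields.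
Variable R : realType.
Implicit Types (Omega : set (space3 R)) (w phi : space3 R -> R).
Implicit Types (U V : 'I_3 -> space3 R -> R).
Local Notation mu3 := (@lebesgue3 R).

Lemma smooth0 : smooth (cst 0 : space3 R -> R).
Proof.
have pd0 k : pd k (cst 0 : space3 R -> R) = cst 0.
  by apply/funext => x; rewrite /pd derive_cst.
move=> s; have -> : iter_pd s (cst 0 : space3 R -> R) = cst 0.
  by elim: s => //= k s ->.
by split=> [x|k x]; [exact: cvg_cst|exact: derivable_cst].
Qed.

Lemma smooth_sobolev1 Omega w : open Omega -> bounded_set Omega -> smooth w ->
  sobolev1 Omega w (fun k => pd k w).
Proof.
move=> oO bO sw; split; first exact/continuous_inL2/smooth_continuous.
move=> k; split; last exact: smooth_weak_pd.
exact/continuous_inL2/smooth_continuous/smooth_pd.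
Qed.

(** The constant sequence approximates [w] in the trace. *)
Lemma smooth_trace Omega w : smooth w -> trace Omega w (fun k => pd k w) w.
Proof.
move=> sw; split.
  by apply: measurable_funTS; apply: continuous_measurable3; exact: smooth_continuous.
have N0 d (T : measurableType d) (m : {measure set T -> \bar R}) (D : set T) (f : T -> R) :
    'N[m]_2%:E[EFin \o ((f \- f)%R \_ D)]%E = 0%E.
  rewrite -[RHS](@Lnorm0 _ _ _ m 2%:E)//.
  by apply: eq_Lnorm => x /=; rewrite patchE /= subrr; case: ifP.
exists (fun=> w); split => //.
- by under eq_fun do rewrite N0; exact: cvg_cst.
- by move=> k; under eq_fun do rewrite N0; exact: cvg_cst.
- by under eq_fun do rewrite N0; exact: cvg_cst.
Qed.

Definition cfield U : vfield R := fun j x => (U j x)%:C.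
Definition cgrad U : vgrad R := fun i j x => (pd i (U j) x)%:C.

Lemma pd_cst0 : (fun k => pd k (cst 0 : space3 R -> R)) = (fun k => cst 0).
Proof. by apply/funext => k; apply/funext => x; rewrite /pd derive_cst. Qed.

Lemma H1_cfield Omega U : open Omega -> bounded_set Omega ->
  (forall j, smooth (U j)) -> H1 Omega (cfield U) (cgrad U).
Proof.
move=> oO bO sU j; split; first exact: (smooth_sobolev1 oO bO (sU j)).
by have := smooth_sobolev1 oO bO smooth0; rewrite pd_cst0.
Qed.

Lemma vtrace_cfield Omega U : (forall j, smooth (U j)) ->
  vtrace Omega (cfield U) (cgrad U) (cfield U).
Proof.
move=> sU j; split; first exact: (smooth_trace Omega (sU j)).
by have := @smooth_trace Omega _ smooth0; rewrite pd_cst0.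
Qed.

Lemma cintegral_real Omega (r : space3 R -> R) (F : space3 R -> R[i]) :
  (forall x, F x = (r x)%:C) ->
  cintegral Omega F = (\int[mu3]_(x in Omega) r x)%R%:C.
Proof.
move=> Fr; have -> : F = fun x => (r x)%:C by apply/funext.
rewrite /cintegral /re /im /=; congr (_ +i* _).
by rewrite /Rintegral integral0_eq.
Qed.

(** Classical solutions on the whole space; they restrict to weak solutions on
    every bounded open set. *)
Definition lame_field (lambda mu : R) U : Prop :=
  (forall j, smooth (U j)) /\
  forall i x, mu * (\sum_k pd k (pd k (U i)) x) +
    (lambda + mu) * (\sum_k pd i (pd k (U k)) x) = 0.

Lemma Rintegral_sum3 Omega (h : 'I_3 -> space3 R -> R) :
  open Omega -> bounded_set Omega -> (forall k, continuous (h k)) ->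
  \int[mu3]_(x in Omega) (\sum_k h k x) = \sum_k \int[mu3]_(x in Omega) h k x.
Proof.
move=> oO bO ch; have mO := open_measurable3 oO.
have c2 : continuous (fun x => h (lift ord0 ord0) x + h (lift ord0 (lift ord0 ord0)) x).
  by move=> x; apply: cvgD; exact: ch.
have -> : (fun x => \sum_k h k x) = (fun x => h ord0 x +
    (h (lift ord0 ord0) x + h (lift ord0 (lift ord0 ord0)) x)).
  by apply/funext => x; rewrite !big_ord_recl big_ord0 addr0.
rewrite !big_ord_recl big_ord0 addr0 !RintegralD//; exact: continuous_integrable3.
Qed.

Lemma lame_equation_field Omega (lambda mu : R) U : open Omega ->
  bounded_set Omega -> lame_field lambda mu U ->
  lame_equation Omega lambda mu (cgrad U).
Proof.
move=> oO bO [sU lU] phi i tphi; have mO := open_measurable3 oO.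
have sphi := tphi.1.
pose h k x := mu * (pd k (U i) x * pd k phi x) +
  (lambda + mu) * (pd k (U k) x * pd i phi x).
pose h' k x := mu * (pd k (pd k (U i)) x * phi x) +
  (lambda + mu) * (pd i (pd k (U k)) x * phi x).
rewrite (@cintegral_real _ (fun x => \sum_k h k x)); last first.
  have gen (A B C : 'I_3 -> R) (l p : R) :
      mu%:C * (\sum_k (A k)%:C * (B k)%:C) + l%:C * ((\sum_k (C k)%:C) * p%:C)
      = (\sum_k (mu * (A k * B k) + l * (C k * p)))%:C.
    rewrite big_split /= -!mulr_sumr -mulr_suml rmorphD !rmorphM !rmorph_sum /=.
    by under [in RHS]eq_bigr do rewrite rmorphM.
  by move=> x; exact: gen.
have cc w v : smooth w -> smooth v -> continuous (fun x => w x * v x).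
  by move=> sw sv x; apply: cvgM; exact: smooth_continuous.
have cZ a w : continuous w -> continuous (fun x => a * w x : R).
  by move=> cw x; apply: cvgM; [exact: cvg_cst|exact: cw].
have s1 k j := smooth_pd k (sU j).
have s2 k := smooth_pd k sphi.
have s3 l k j := smooth_pd l (s1 k j).
have c1 k j l := cc _ _ (s1 k j) (s2 l); have c2 l k j := cc _ _ (s3 l k j) sphi.
have lin (a b : R) (f g : space3 R -> R) : continuous f -> continuous g ->
    \int[mu3]_(x in Omega) (a * f x + b * g x) =
    a * \int[mu3]_(x in Omega) f x + b * \int[mu3]_(x in Omega) g x.
  move=> cf cg; rewrite RintegralD//; try by apply: continuous_integrable3 => //; exact: cZ.
  by rewrite !RintegralZl//; exact: continuous_integrable3.
rewrite Rintegral_sum3//; last first.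
  by move=> k x; apply: cvgD; apply: cZ; exact: (c1 _ _ _).
have -> : \sum_k \int[mu3]_(x in Omega) h k x = - \sum_k \int[mu3]_(x in Omega) h' k x.
  rewrite -sumrN; apply: eq_bigr => k _.
  refine (etrans (lin _ _ _ _ (c1 k i k) (c1 k k i)) _).
  refine (etrans _ (esym (congr1 -%R (lin _ _ _ _ (c2 k k i) (c2 i k k))))).
  have w1 := smooth_weak_pd k oO bO (s1 k i) tphi.
  have w2 := smooth_weak_pd i oO bO (s1 k k) tphi.
  have neg (m l a b a' b' : R) : a = - a' -> b = - b' ->
    m * a + l * b = - (m * a' + l * b') by move=> -> ->; ring.
  exact: (neg mu (lambda + mu) _ _ _ _ w1 w2).
rewrite -Rintegral_sum3//; last first.
  by move=> k x; apply: cvgD; apply: cZ; exact: (c2 _ _ _).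
have gen (A B : 'I_3 -> R) (p : R) :
    mu * (\sum_k A k) + (lambda + mu) * (\sum_k B k) = 0 ->
    \sum_k (mu * (A k * p) + (lambda + mu) * (B k * p)) = 0.
  move=> AB0; rewrite big_split /= -!mulr_sumr -!mulr_suml !mulrA.
  by rewrite -mulrDl AB0 mul0r.
rewrite /Rintegral integral0_eq ?oppr0// => x _.
congr (_%:E); exact: (gen _ _ (phi x) (lU i x)).
Qed.

(** Classical Lame fields are admissible Dirichlet solutions with their own
    restriction as data, so a vanishing linearized map annihilates the form on
    them.  Their gradients are real, hence so is the form. *)
Lemma field_orthogonality Omega (lambda mu : R) (dC : tensor_field R)
    (L : vfield R -> vfield R -> R[i]) U V :
  open Omega -> bounded_set Omega ->
  linearized_DtN Omega lambda mu dC L ->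
  (forall f g, H12 Omega f -> H12 Omega g -> L f g = 0) ->
  lame_field lambda mu U -> lame_field lambda mu V ->
  \int[mu3]_(x in Omega) (\sum_i \sum_j \sum_k \sum_l
    dC i j k l x * pd i (U j) x * pd k (V l) x) = 0.
Proof.
move=> oO bO LD L0 lU lV.
have sol W : lame_field lambda mu W ->
    lame_solution Omega lambda mu (cfield W) (cfield W) (cgrad W).
  move=> lW; split; [apply: H1_cfield => //; exact: lW.1|
    apply: vtrace_cfield; exact: lW.1|exact: lame_equation_field].
have H12W W : lame_field lambda mu W -> H12 Omega (cfield W).
  by move=> lW; exists (cfield W), (cgrad W); split; have [] := sol _ lW.
have := LD _ _ (H12W _ lU) (H12W _ lV) _ _ _ _ (sol _ lU) (sol _ lV).
rewrite L0; [|exact: H12W|exact: H12W].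
rewrite /elastic_form => /esym.
rewrite (@cintegral_real _ (fun x => \sum_i \sum_j \sum_k \sum_l
    dC i j k l x * pd i (U j) x * pd k (V l) x)).
  by move=> /complexI.
move=> x; rewrite /cgrad; do 4 (rewrite rmorph_sum /=; apply: eq_bigr => ? _).
by rewrite !rmorphM.
Qed.
End smooth_fields.

(** * Polynomial approximation of a step *)

Section threshold.
Variable R : realType.
Implicit Types (r t y : R).

Lemma bernoulli_le y m : 0 <= y -> y <= 1 -> 1 - m%:R * y <= (1 - y) ^+ m.
Proof.
move=> y0 y1; elim: m => [|m IH]; first by rewrite mul0r subr0 expr0.
rewrite exprS; have h : 0 <= 1 - y by lra.
apply: le_trans (ler_wpM2l h IH); rewrite -natr1.
have : 0 <= m%:R * y ^+ 2 by rewrite mulr_ge0// sqr_ge0.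
by move=> ?; nra.
Qed.

(** Since [1 + m y <= (1 + y) ^ m], the left-hand side is at most
    [(1 - y ^ 2) ^ m], hence at most one. *)
Lemma bernoulli_ge y m : 0 <= y -> y <= 1 -> (1 - y) ^+ m * (1 + m%:R * y) <= 1.
Proof.
move=> y0 y1; elim: m => [|m IH]; first by rewrite expr0 mul0r addr0 mulr1.
rewrite exprSr -mulrA; apply: le_trans IH.
apply: ler_wpM2l; first by rewrite exprn_ge0; lra.
have : 0 <= m%:R * y ^+ 2 by rewrite mulr_ge0// sqr_ge0.
have : 0 <= y ^+ 2 by rewrite sqr_ge0.
by rewrite -natr1; nra.
Qed.

Lemma cvg_natr_geometric r : 0 <= r -> r < 1 ->
  (fun n => n%:R * r ^+ n) @ \oo --> (0 : R).
Proof.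
move=> r0 r1.
(* Half of the geometric decay absorbs the factor [n]. *)
pose p := Num.sqrt r.
have p0 : 0 <= p by exact: sqrtr_ge0.
have p1 : p < 1 by rewrite /p -sqrtr1 ltr_sqrt.
have rE : r = p ^+ 2 by rewrite sqr_sqrtr.
have bound n : n%:R * p ^+ n <= (1 - p)^-1.
  have h : 0 < 1 - p by lra.
  rewrite -[leRHS]mul1r ler_pdivlMr//.
  have := @bernoulli_ge (1 - p) n (ltW h) ltac:(lra).
  rewrite opprB addrC subrK => H.
  have h2 : 0 <= p ^+ n by rewrite exprn_ge0.
  by move: H; rewrite mulrDr mulr1; nra.
apply: (@squeeze_cvgr _ _ _ _ (cst 0) (fun n => (1 - p)^-1 * p ^+ n)).
- apply: nearW => n; rewrite /= mulr_ge0 ?exprn_ge0//=.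
  by rewrite rE -exprM mul2n -addnn exprD mulrA ler_wpM2r// exprn_ge0.
- exact: cvg_cst.
- rewrite -[X in _ --> X](mulr0 (1 - p)^-1); apply: cvgM; first exact: cvg_cst.
  by apply: cvg_expr; rewrite ger0_norm.
Qed.

(** A step as a limit of polynomials with values in [[0, 1]].  By the two
    inequalities above, [(1 - t ^ n) ^ m] is close to one when [m t ^ n] is small
    and close to zero when it is large; for [m = n 2 ^ n] the transition is at
    [1 / 2], and the factor [n] settles the case [t = 1 / 2]. *)
Lemma cvg_threshold t : 0 <= t -> t <= 1 ->
  (fun n => (1 - t ^+ n) ^+ (n * 2 ^ n)) @ \oo --> ((t < 2^-1)%R%:R : R).
Proof.
move=> t0 t1.
have tn0 n : 0 <= t ^+ n by rewrite exprn_ge0.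
have tn1 n : t ^+ n <= 1 by rewrite exprn_ile1.
have ge0 n m : 0 <= (1 - t ^+ n) ^+ m by rewrite exprn_ge0// subr_ge0.
have mE n : (n * 2 ^ n)%:R * t ^+ n = n%:R * (2 * t) ^+ n :> R.
  by rewrite natrM natrX exprMn mulrA.
case: ltP => h.
- apply: (@squeeze_cvgr _ _ _ _ (fun n => 1 - n%:R * (2 * t) ^+ n) (cst 1)).
  + apply: nearW => n; rewrite -mE bernoulli_le//=.
    by rewrite exprn_ile1 ?subr_ge0// gerBl.
  + rewrite -[X in _ --> X](subr0 (1 : R)); apply: cvgB; first exact: cvg_cst.
    by apply: cvg_natr_geometric; lra.
  + exact: cvg_cst.
- apply: (@squeeze_cvgr _ _ _ _ (cst 0) (fun n => (n.+1%:R)^-1)).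
  + apply: nearW => n; rewrite ge0/= -[leRHS]mul1r ler_pdivlMr ?ltr0n//.
    apply: le_trans (@bernoulli_ge (t ^+ n) (n * 2 ^ n) _ _) => //.
    apply: ler_wpM2l => //; rewrite mE -natr1 addrC lerD2l ler_peMr//.
    by rewrite exprn_ege1; lra.
  + exact: cvg_cst.
  + exact: cvg_harmonic.
Qed.
End threshold.

(** * Injectivity of the Laplace transform on a half-space *)

Section dot.
Variable R : realType.
Implicit Types (a b : 'I_3 -> R) (x : space3 R).

Definition dot a x : R := \sum_i a i * coords x i 0.

Lemma dot3 a x : dot a x =
  a ord0 * x.1.1 + a (lift ord0 ord0) * x.1.2 + a (lift ord0 (lift ord0 ord0)) * x.2.
Proof. by rewrite /dot !big_ord_recl big_ord0 addr0 !mxE /= addrA. Qed.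

Lemma dot_line a k h x : dot a (h *: ebasis R k + x) = h * a k + dot a x.
Proof.
have lin (c d e u v w : R) : h *: ((c, d, e) : space3 R) + (u, v, w) =
    (h * c + u, h * d + v, h * e + w) by [].
case: x => [[u v] w]; rewrite /ebasis lin !dot3 /=.
by case: k => -[|[|[|//]]] i /=;
  [rewrite (_ : Ordinal i = ord0)|rewrite (_ : Ordinal i = lift ord0 ord0)|
   rewrite (_ : Ordinal i = lift ord0 (lift ord0 ord0))];
  [ring|exact: val_inj|ring|exact: val_inj|ring|exact: val_inj].
Qed.

Lemma continuous_dot a : continuous (dot a).
Proof.
have -> : dot a = (fun x => a ord0 * x.1.1 + a (lift ord0 ord0) * x.1.2 +
   a (lift ord0 (lift ord0 ord0)) * x.2) by apply/funext => x; exact: dot3.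
move=> x; apply: cvgD; first apply: cvgD; apply: cvgM; try exact: cvg_cst.
- by apply: (@cvg_comp _ _ _ fst fst); [exact: cvg_fst|exact: cvg_fst].
- by apply: (@cvg_comp _ _ _ fst snd); [exact: cvg_fst|exact: cvg_snd].
- exact: cvg_snd.
Qed.

Lemma dotDl a b x : dot (fun i => a i + b i) x = dot a x + dot b x.
Proof. by rewrite !dot3; ring. Qed.

Lemma dotZl c a x : dot (fun i => c * a i) x = c * dot a x.
Proof. by rewrite !dot3; ring. Qed.

Lemma continuous_expR_dot a : continuous (fun x => expR (dot a x)).
Proof.
by move=> x; apply: continuous_comp; [exact: continuous_dot|exact: continuous_expR].
Qed.
End dot.

Section laplace.
Variables (R : realType) (Omega : set (space3 R)) (f : space3 R -> R) (w : 'I_3 -> R).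
Hypotheses (oO : open Omega) (bO : bounded_set Omega).
Local Notation mu3 := (@lebesgue3 R).
Hypothesis fi : mu3.-integrable (Omega : set (mspace3 R)) (EFin \o f).

Let mO : measurable (Omega : set (mspace3 R)). Proof. exact: open_measurable3. Qed.
Implicit Types (phi psi : space3 R -> R) (B : set (space3 R)).

(** A Laplace transform that vanishes on a half-space forces the function to
    vanish.  The weights under which all transforms on the half-space vanish form a
    linear space, closed under bounded pointwise limits and, since the half-space
    absorbs its own closure under addition, under multiplication by [expR (dot k x)]
    for [k] in the closed half-space.  Such exponentials generate, through
    polynomial approximations of steps, the indicators of rays in each
    coordinate, hence of all Borel sets. *)
Let half_space (k : 'I_3 -> R) := 0 < \sum_i k i * w i.

Let bounded phi M := forall x, Omega x -> `|phi x| <= M.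

Let vanishing phi := [/\ measurable_fun setT (phi : mspace3 R -> R),
  exists M, bounded phi M &
  forall k, half_space k -> \int[mu3]_(x in Omega) (f x * (phi x * expR (dot k x))) = 0].

Let integrable_mul phi M : measurable_fun setT (phi : mspace3 R -> R) ->
  bounded phi M ->
  mu3.-integrable (Omega : set (mspace3 R)) (EFin \o (fun x => f x * phi x)).
Proof.
move=> mphi phiM.
apply: (@integrableMl _ _ _ mu3 Omega mO (EFin \o f) phi) => //.
  exact: measurable_funTS.
exists M; split=> [|N MN x Ox]; first exact: num_real.
by apply: (le_trans (phiM _ Ox)); exact: ltW.
Qed.

Let bounded_exp k : exists M, bounded (fun x => expR (dot k x)) M.
Proof.
have [M _ h] := continuous_bounded3 (@continuous_expR_dot _ k) bO.
by exists M.
Qed.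

Let boundedM phi psi : (exists M, bounded phi M) -> (exists M, bounded psi M) ->
  exists M, bounded (fun x => phi x * psi x) M.
Proof.
move=> [M hM] [N hN]; exists (M * N) => x Ox.
by rewrite normrM ler_pM//; [exact: hM|exact: hN].
Qed.

Let measurable_exp k :
  measurable_fun setT ((fun x => expR (dot k x)) : mspace3 R -> R).
Proof. by apply: continuous_measurable3; exact: continuous_expR_dot. Qed.

Let vanishing_integrable phi k : vanishing phi ->
  mu3.-integrable (Omega : set (mspace3 R))
    (EFin \o (fun x => f x * (phi x * expR (dot k x)))).
Proof.
move=> [mphi bphi _]; have [M hM] := boundedM bphi (bounded_exp k).
by apply: integrable_mul hM; exact: measurable_funM.
Qed.

Let vanishing_exp phi k : 0 <= \sum_i k i * w i -> vanishing phi ->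
  vanishing (fun x => phi x * expR (dot k x)).
Proof.
move=> k0 [mphi bphi h]; split; [exact: measurable_funM|exact: boundedM|].
move=> l hl; under eq_Rintegral do
  rewrite -[X in _ * X]mulrA -expRD -dotDl.
apply: h; rewrite /half_space; under eq_bigr do rewrite mulrDl.
by rewrite big_split /= ltr_wpDl.
Qed.

Let vanishing_lin a b phi psi : vanishing phi -> vanishing psi ->
  vanishing (fun x => a * phi x + b * psi x).
Proof.
move=> gphi gpsi; have [mphi [M hM] h] := gphi; have [mpsi [N hN] h'] := gpsi.
split.
- by apply: measurable_funD; apply: measurable_funM.
- exists (`|a| * M + `|b| * N) => x Ox.
  apply: (le_trans (ler_normD _ _)); rewrite !normrM.
  by apply: lerD; apply: ler_wpM2l => //; [exact: hM|exact: hN].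
- move=> k hk.
  transitivity (\int[mu3]_(x in Omega) (a * (f x * (phi x * expR (dot k x))) +
      b * (f x * (psi x * expR (dot k x))))).
    by apply: eq_Rintegral => x _; ring.
  rewrite RintegralD//; last 2 first.
  + exact: (integrableZl mO a (vanishing_integrable k gphi)).
  + exact: (integrableZl mO b (vanishing_integrable k gpsi)).
  rewrite !RintegralZl//; try exact: vanishing_integrable.
  by rewrite h// h'// !mulr0 addr0.
Qed.

Let vanishing_int0 phi k : vanishing phi -> half_space k ->
  (\int[mu3]_(x in Omega) (f x * (phi x * expR (dot k x)))%:E = 0)%E.
Proof.
move=> gphi hk; have [_ _ h] := gphi.
rewrite -[LHS]fineK; first by rewrite [X in X%:E](h _ hk).
exact: integrable_fin_num (vanishing_integrable k gphi).
Qed.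

Let vanishing_lim (phi_ : nat -> space3 R -> R) phi M :
  (forall n, vanishing (phi_ n)) -> (forall n, bounded (phi_ n) M) ->
  measurable_fun setT (phi : mspace3 R -> R) ->
  (forall x, Omega x -> phi_ ^~ x @ \oo --> phi x) -> vanishing phi.
Proof.
move=> gn bn mphi cv.
have b : bounded phi M.
  move=> x Ox; have cvn : (fun n => `|phi_ n x|) @ \oo --> `|phi x|.
    by apply: cvg_norm; exact: cv.
  by apply: (@cvgr_to_le _ _ _ _ _ _ _ cvn); apply: nearW => n; exact: bn.
split=> //; first by exists M.
move=> k hk.
have fe : mu3.-integrable (Omega : set (mspace3 R)) (EFin \o (fun x => f x * expR (dot k x))).
  by have [N hN] := bounded_exp k; exact: integrable_mul hN.
have fe1 : mu3.-integrable (Omega : set (mspace3 R))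
    (fun x => M%:E * (`|f x * expR (dot k x)|)%:E)%E.
  by apply: integrableZl => //; exact: integrable_norm fe.
have mf : measurable_fun (Omega : set (mspace3 R)) f.
  by apply/measurable_EFinP; exact: measurable_int fi.
have mprod psi : measurable_fun setT (psi : mspace3 R -> R) ->
    measurable_fun (Omega : set (mspace3 R)) (fun x => (f x * (psi x * expR (dot k x)))%:E).
  move=> mpsi; apply/measurable_EFinP; apply: measurable_funM => //.
  by apply: measurable_funTS; apply: measurable_funM.
have cvI : (fun n => \int[mu3]_(x in Omega) (f x * (phi_ n x * expR (dot k x)))%:E)%E
    @ \oo --> (\int[mu3]_(x in Omega) (f x * (phi x * expR (dot k x)))%:E)%E.
  have mn n := mprod _ (let: And3 m _ _ := gn n in m).
  have cvx : {ae mu3, forall x, Omega x ->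
      (fun n => (f x * (phi_ n x * expR (dot k x)))%:E) @ \oo -->
      (f x * (phi x * expR (dot k x)))%:E}.
    apply: aeW => x /= Ox; apply: cvg_EFin; first exact: nearW.
    apply: cvgM; first exact: cvg_cst.
    by apply: cvgM; [exact: cv|exact: cvg_cst].
  have dom : {ae mu3, forall x n, Omega x ->
      (`|(f x * (phi_ n x * expR (dot k x)))%:E| <= M%:E * (`|f x * expR (dot k x)|)%:E)%E}.
    apply: aeW => x n Ox /=; rewrite -EFinM lee_fin mulrCA normrM ler_wpM2r//.
    exact: bn.
  by have [] := dominated_convergence mO mn (mprod _ mphi) cvx fe1 dom.
have E0 : (fun n => \int[mu3]_(x in Omega) (f x * (phi_ n x * expR (dot k x)))%:E)%E
    = (fun _ => 0%E).
  by apply/funext => n; exact: vanishing_int0.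
rewrite /Rintegral (_ : (\int[mu3]_(x in Omega) _)%E = 0%E)//.
move: cvI; rewrite E0 => /cvg_lim <-//; first exact: lim_cst.
Qed.

Let vanishing_scale a phi : vanishing phi -> vanishing (fun x => a * phi x).
Proof.
move=> g; have := vanishing_lin a 0 g g.
by congr vanishing; apply/funext => x; rewrite mul0r addr0.
Qed.

Let coord_bound i (c : R) : exists2 M, 0 < M & forall x, Omega x -> `|coords x i 0 - c| <= M.
Proof.
have [M M0 h] := bounded_box3 bO; exists (M + `|c|); first by rewrite ltr_pwDl.
move=> x /h [[]]; rewrite /= !in_itv /= -!ler_norml => h1 h2 h3.
apply: (le_trans (ler_normB _ _)); rewrite lerD2r mxE.
by case: i => -[|[|[|]]].
Qed.

Let continuous_coord i : continuous (fun x : space3 R => coords x i 0).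
Proof.
have -> : (fun x : space3 R => coords x i 0) = dot (fun j => (j == i)%:R).
  apply/funext => x; rewrite /dot (bigD1 i)//= eqxx mul1r big1 ?addr0// => j /negbTE ->.
  by rewrite mul0r.
exact: continuous_dot.
Qed.

(** Here [t = expR (s * (x_i - c)) / 2] crosses [1 / 2] exactly on the hyperplane
    [x_i = c], and the bound by [ln 2] keeps it in [[0, 1]]. *)
Let vanishing_threshold i (s c : R) phi :
  0 <= s * w i -> (forall x, Omega x -> s * (coords x i 0 - c) <= ln 2) -> vanishing phi ->
  vanishing (fun x => phi x * \1_[set x | s * (coords x i 0 - c) < 0] x).
Proof.
move=> swi sx gphi.
pose k j : R := if j == i then s else 0.
have dk x : dot k x = s * coords x i 0.
  rewrite /dot (bigD1 i)//= /k eqxx big1 ?addr0// => j /negbTE ->.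
  by rewrite mul0r.
have kw : 0 <= \sum_j k j * w j.
  rewrite (bigD1 i)//= /k eqxx big1 ?addr0// => j /negbTE ->.
  by rewrite mul0r.
pose t x := expR (s * (coords x i 0 - c)) / 2.
have tE x : t x = (expR (- (s * c)) / 2) * expR (dot k x).
  by rewrite /t mulrBr expRD dk; ring.
have t0 x : 0 <= t x by rewrite divr_ge0 ?expR_ge0.
have t1 x : Omega x -> t x <= 1.
  move=> Ox; rewrite /t ler_pdivrMr// mul1r.
  by rewrite -ler_ln ?posrE ?expR_gt0// expRK sx.
have gt psi n : vanishing psi -> vanishing (fun x => psi x * t x ^+ n).
  move=> g; elim: n => [|n IH].
    by move: g; congr vanishing; apply/funext => x; rewrite expr0 mulr1.
  move: (vanishing_scale (expR (- (s * c)) / 2) (vanishing_exp kw IH)).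
  by congr vanishing; apply/funext => x; rewrite exprSr; move: (t x ^+ n) => u; rewrite tE; ring.
have gq n m : vanishing (fun x => phi x * (1 - t x ^+ n) ^+ m).
  elim: m => [|m IH].
    by move: gphi; congr vanishing; apply/funext => x; rewrite expr0 mulr1.
  move: (vanishing_lin 1 (-1) IH (gt _ n IH)).
  by congr vanishing; apply/funext => x; rewrite exprS; ring.
have [mphi [M hM] _] := gphi.
have oS : open [set x : space3 R | s * (coords x i 0 - c) < 0].
  apply: (@open_comp _ _ (fun x : space3 R => s * (coords x i 0 - c)) [set y | y < 0]).
    move=> x _; apply: cvgM; first exact: cvg_cst.
    by apply: cvgB; [exact: continuous_coord|exact: cvg_cst].
  exact: open_lt.
apply: (@vanishing_lim (fun n x => phi x * (1 - t x ^+ n) ^+ (n * 2 ^ n)) _ M).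
- by move=> n; exact: gq.
- move=> n x Ox; apply: le_trans (hM _ Ox); rewrite normrM ler_piMr//.
  have h0 : 0 <= 1 - t x ^+ n by rewrite subr_ge0 exprn_ile1// t1.
  rewrite ger0_norm ?exprn_ge0// exprn_ile1// gerBl exprn_ge0//.
- apply: measurable_funM => //; apply: measurable_indic.
  exact: open_measurable3.
- move=> x Ox; apply: cvgM; first exact: cvg_cst.
  rewrite indicE (_ : (x \in _) = (t x < 2^-1)%R); first exact: cvg_threshold (t1 _ Ox).
  rewrite /t ltr_pdivrMr// mulVf// expR_lt1.
  by apply/idP/idP; rewrite inE.
Qed.

(** Quantifying over all weights makes this class of sets closed under
    intersection, and it is then a sigma-algebra. *)
Let localizes B := measurable (B : set (mspace3 R)) /\
  forall phi, vanishing phi -> vanishing (fun x => phi x * \1_B x).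

(** The exponentials available in the [i]-th coordinate are those whose frequency
    has the sign of [w i], hence the direction of the ray. *)
Let localizes_ray i (c : R) :
  localizes (if 0 <= w i then [set x | coords x i 0 < c] else [set x | c < coords x i 0]).
Proof.
have [M M0 hM] := coord_bound i c.
have ln0 : 0 < ln 2 :> R by rewrite ln_gt0// ltr1n.
pose d : R := ln 2 / M; have d0 : 0 < d by rewrite divr_gt0.
have bd x (s : R) : Omega x -> `|s| = d -> s * (coords x i 0 - c) <= ln 2.
  move=> Ox sd; apply: (le_trans (ler_norm _)); rewrite normrM sd.
  by rewrite /d mulrAC ler_pdivrMr// ler_wpM2l ?hM// ltW.
have cc := @continuous_coord i.
case: ifPn => wi; split.
- by apply: open_measurable3; apply: (@open_comp _ _ (fun x : space3 R => coords x i 0) [set y | y < c]) => //; exact: open_lt.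
- move=> phi gphi; have -> : [set x | coords x i 0 < c] = [set x : space3 R | d * (coords x i 0 - c) < 0].
    by apply/seteqP; split=> x /=; rewrite pmulr_rlt0// subr_lt0.
  apply: vanishing_threshold => //; first by rewrite mulr_ge0// ltW.
  by move=> x Ox; apply: bd => //; rewrite gtr0_norm.
- by apply: open_measurable3; apply: (@open_comp _ _ (fun x : space3 R => coords x i 0) [set y | c < y]) => //; exact: open_gt.
- move=> phi gphi; have -> : [set x | c < coords x i 0] = [set x : space3 R | - d * (coords x i 0 - c) < 0].
    by apply/seteqP; split=> x /=; rewrite mulNr oppr_lt0 pmulr_rgt0// subr_gt0.
  apply: vanishing_threshold => //.
    by rewrite mulNr -mulrN mulr_ge0 ?ltW// oppr_gt0 ltNge.
  by move=> x Ox; apply: bd => //; rewrite normrN gtr0_norm.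
Qed.

Let localizesC B : localizes B -> localizes (~` B).
Proof.
move=> [mB gB]; split=> [|phi gphi]; first exact: measurableC.
move: (vanishing_lin 1 (-1) gphi (gB _ gphi)); congr vanishing; apply/funext => x.
rewrite !indicE in_setC; case: (x \in B) => /=; ring.
Qed.

Let localizesU A B : localizes A -> localizes B -> localizes (A `|` B).
Proof.
move=> [mA gA] [mB gB]; split=> [|phi gphi]; first exact: measurableU.
move: (vanishing_lin 1 (-1) (vanishing_lin 1 1 (gA _ gphi) (gB _ gphi)) (gA _ (gB _ gphi))).
congr vanishing; apply/funext => x.
rewrite !indicE in_setU; case: (x \in A) (x \in B) => [] [] /=; ring.
Qed.

Let localizes_bigcup (F : nat -> set (space3 R)) :
  (forall n, localizes (F n)) -> localizes (\bigcup_n F n).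
Proof.
move=> lF; split=> [|phi gphi]; first by apply: bigcupT_measurable => n; exact: (lF n).1.
pose U n := \big[setU/set0]_(k < n) F k.
have lU n : localizes (U n).
  elim: n => [|n IH]; last by rewrite /U big_ord_recr /=; exact: localizesU.
  split=> [|psi gpsi]; first by rewrite /U big_ord0; exact: measurable0.
  move: (vanishing_scale 0 gpsi); congr vanishing; apply/funext => x.
  by rewrite /U big_ord0 indic0 mulr0 mul0r.
have [mphi [M hM] _] := gphi.
apply: (@vanishing_lim (fun n x => phi x * \1_(U n) x) _ M).
- by move=> n; exact: (lU n).2.
- move=> n x Ox; apply: le_trans (hM _ Ox); rewrite normrM ler_piMr// indicE.
  by case: (x \in _); rewrite ?normr1 ?normr0.
- apply: measurable_funM => //; apply: measurable_indic.
  by apply: bigcupT_measurable => n; exact: (lF n).1.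
- move=> x Ox; apply: cvgM; first exact: cvg_cst.
  have [[n _ Fnx]|nF] := pselect ((\bigcup_n F n) x).
    have -> : \1_(\bigcup_n F n) x = 1 :> R by rewrite indicE mem_set//; exists n.
    apply: cvg_near_cst; exists n.+1 => // m /= nm.
    rewrite indicE mem_set// /U -(bigcup_mkord m F); by exists n.
  have -> : \1_(\bigcup_n F n) x = 0 :> R by rewrite indicE memNset.
  apply: cvg_near_cst; apply: nearW => n; rewrite indicE memNset//.
  by rewrite /U -(bigcup_mkord n F) => -[k _ Fk]; apply: nF; exists k.
Qed.

Let sigma_algebra_localizes : sigma_algebra setT localizes.
Proof.
split.
- split=> [|phi gphi]; first exact: measurable0.
  by move: (vanishing_scale 0 gphi); congr vanishing; apply/funext => x; rewrite indic0 mulr0 mul0r.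
- by move=> A lA; rewrite setTD; exact: localizesC.
- exact: localizes_bigcup.
Qed.

Let localizes_measurable B : measurable (B : set (mspace3 R)) -> localizes B.
Proof.
(* Rays make each coordinate measurable for the sigma-algebra of these sets, and
   therefore also the identity map into the product of three Borel lines. *)
pose T := g_sigma_algebraType (localizes : set (set (space3 R))).
have TE (A : set T) : measurable A -> localizes A.
  by rewrite /measurable /= (sigma_algebra_id sigma_algebra_localizes).
have ET (A : set (space3 R)) : localizes A -> measurable (A : set T).
  by move=> lA; apply: sub_sigma_algebra.
have mcoord i : measurable_fun setT ((fun x => coords x i 0) : T -> measurableTypeR R).
  have ray := localizes_ray i; have [wi|/negbTE wi] := boolP (0 <= w i).
    apply: (@measurability _ _ T (measurableTypeR R) setT _ _ (RGenInftyO.measurableE R)).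
    move=> _ [_ [c ->] <-].
    rewrite setTI; apply: ET; move: (ray c); rewrite wi; congr localizes.
  apply: (@measurability _ _ T (measurableTypeR R) setT _ _ (RGenOInfty.measurableE R)).
    move=> _ [_ [c ->] <-].
  rewrite setTI; apply: ET; move: (ray c); rewrite wi; congr localizes.
  by apply/seteqP; split => x /=; rewrite in_itv /= andbT.
have mid : measurable_fun setT (fun x : T => (x : mspace3 R)).
  have -> : (fun x : T => (x : mspace3 R)) = (fun x : T =>
      ((coords x ord0 0, coords x (lift ord0 ord0) 0), coords x (lift ord0 (lift ord0 ord0)) 0)).
    by apply/funext => -[[u v] z]; rewrite !mxE.
  by apply: measurable_fun_pair => //; exact: measurable_fun_pair.
by move=> mB; apply: TE; rewrite -[B]setTI; exact: mid.
Qed.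

Hypothesis w0 : 0 < \sum_i w i * w i.
Hypothesis laplace0 : forall k, 0 < \sum_i k i * w i ->
  \int[mu3]_(x in Omega) (f x * expR (dot k x)) = 0.

Lemma laplace_injective : {ae mu3, forall x, Omega x -> f x = 0}.
Proof.
have vanishing_cst1 : vanishing (cst 1).
  split; first exact: measurable_cst.
    by exists 1 => x _; rewrite normr1.
  by move=> k /laplace0 <-; apply: eq_Rintegral => x _; rewrite mul1r.
have fe : mu3.-integrable (Omega : set (mspace3 R)) (EFin \o (fun x => f x * expR (dot w x))).
  by have [N hN] := bounded_exp w; exact: integrable_mul hN.
have : ae_eq mu3 (Omega : set (mspace3 R)) (EFin \o (fun x => f x * expR (dot w x))) (cst 0%E).
  apply: integral_ae_eq => // E EO mE; rewrite integral0.
  have := vanishing_int0 ((localizes_measurable mE).2 _ vanishing_cst1) w0.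
  move=> <-; rewrite [LHS]integral_mkcond [RHS]integral_mkcond.
  apply: eq_integral => x _; rewrite !patchE indicE mul1r.
  case: ifPn => [xE|xE]; rewrite ?mul1r ?mul0r ?mulr0 ?if_same//.
  by rewrite mem_set//; apply: EO; move: xE; rewrite inE.
apply: filterS => x /= h Ox; have /eqP := h Ox.
by rewrite eqe mulf_eq0 (gt_eqF (expR_gt0 _)) orbF => /eqP.
Qed.
End laplace.

(** * Exponential solutions of the Lame system *)

Section waves.
Variable R : realType.
Implicit Types (a b d : 'I_3 -> R) (x : space3 R) (k : 'I_3) (p P q Q : R).

(** The real part of [((p - i q) + (P - i Q) (d . x)) exp ((a + i b) . x)].  For
    fixed [a], [b] and [d] these functions are closed under differentiation, so
    that calculus on them is algebra on four numbers. *)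
Definition wave a b d p P q Q x : R :=
  expR (dot a x) * ((p + P * dot d x) * cos (dot b x) + (q + Q * dot d x) * sin (dot b x)).

Lemma is_derive_affine (g : R -> R) (m c g' : R) : is_derive c (1 : R) g g' ->
  is_derive (0 : R) (1 : R) (fun s => g (s * m + c)) (m * g').
Proof.
move=> dg; have dl : is_derive (0 : R) (1 : R) (fun s : R => s * m + c) m.
  apply: is_derive_eq; rewrite /GRing.scale /=; ring.
have dg' : is_derive ((fun s : R => s * m + c) 0) (1 : R) g g'.
  by rewrite mul0r add0r.
by have := @is_derive1_comp _ g (fun s : R => s * m + c) 0 _ _ dg' dl; rewrite mulrC.
Qed.

Lemma is_derive_of_line (F : space3 R -> R) x (v : space3 R) (l : R) :
  is_derive (0 : R) (1 : R) (fun s => F (s *: v + x)) l -> is_derive x v F l.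
Proof.
set G := fun s => _; move=> [dG lE].
have E : (fun h : R => h^-1 *: ((G \o shift 0) (h *: (1 : R)) - G 0)) =
    (fun h : R => h^-1 *: ((F \o shift x) (h *: v) - F x)).
  apply/funext => h; rewrite /G /=; congr (_ *: (F _ - F _)); last by rewrite scale0r add0r.
  by have -> : h *: (1 : R) = h by [exact: mulr1]; rewrite addr0.
by split; [move: dG; rewrite /derivable E|move: lE; rewrite /derive E].
Qed.

Lemma is_derive_wave a b d p P q Q k x :
  is_derive x (ebasis R k) (wave a b d p P q Q)
    (wave a b d (a k * p + b k * q + d k * P) (a k * P + b k * Q)
                (a k * q - b k * p + d k * Q) (a k * Q - b k * P) x).
Proof.
apply: is_derive_of_line.
have -> : (fun s => wave a b d p P q Q (s *: ebasis R k + x)) = (fun s =>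
    expR (s * a k + dot a x) * ((p + P * (s * d k + dot d x)) * cos (s * b k + dot b x) +
      (q + Q * (s * d k + dot d x)) * sin (s * b k + dot b x))).
  by apply/funext => s; rewrite /wave !dot_line.
have de := @is_derive_affine expR (a k) (dot a x) _ (is_derive_expR _).
have dc := @is_derive_affine (@cos R) (b k) (dot b x) _ (is_derive_cos _).
have ds := @is_derive_affine (@sin R) (b k) (dot b x) _ (is_derive_sin _).
apply: is_derive_eq; rewrite /GRing.scale /= /wave !mul0r !add0r; ring.
Qed.

Lemma pd_wave a b d p P q Q k : pd k (wave a b d p P q Q) =
  wave a b d (a k * p + b k * q + d k * P) (a k * P + b k * Q)
             (a k * q - b k * p + d k * Q) (a k * Q - b k * P).
Proof. by apply/funext => x; have [_ <-] := is_derive_wave a b d p P q Q k x. Qed.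

Lemma continuous_wave a b d p P q Q : continuous (wave a b d p P q Q).
Proof.
have lin (c C : R) : continuous (fun x => c + C * dot d x).
  move=> x; apply: cvgD; first exact: cvg_cst.
  by apply: cvgM; [exact: cvg_cst|exact: continuous_dot].
move=> x; apply: cvgM; first exact: continuous_expR_dot.
apply: cvgD; (apply: cvgM; first exact: lin).
- by apply: continuous_comp; [exact: continuous_dot|exact: continuous_cos].
- by apply: continuous_comp; [exact: continuous_dot|exact: continuous_sin].
Qed.

Lemma smooth_wave a b d p P q Q : smooth (wave a b d p P q Q).
Proof.
move=> s; elim/last_ind: s p P q Q => [|s k IH] p P q Q; last first.
  by rewrite /iter_pd foldr_rcons pd_wave; exact: IH.
split=> [|k x]; first exact: continuous_wave.
by have [] := is_derive_wave a b d p P q Q k x.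
Qed.

Definition ip a b : R := \sum_i a i * b i.

Lemma sum_wave a b d (p P q Q : 'I_3 -> R) x :
  \sum_k wave a b d (p k) (P k) (q k) (Q k) x =
  wave a b d (\sum_k p k) (\sum_k P k) (\sum_k q k) (\sum_k Q k) x.
Proof. by rewrite /wave !big_ord_recl !big_ord0; ring. Qed.

Lemma lin_wave a b d (m n p P q Q p' P' q' Q' : R) x :
  m * wave a b d p P q Q x + n * wave a b d p' P' q' Q' x =
  wave a b d (m * p + n * p') (m * P + n * P') (m * q + n * q') (m * Q + n * Q') x.
Proof. by rewrite /wave; ring. Qed.

Lemma wave0 a b d x : wave a b d 0 0 0 0 x = 0.
Proof. by rewrite /wave; ring. Qed.

(** The coefficients come from [(a + i b) . (a + i b)] and [(a + i b) . d]. *)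
Lemma laplacian_wave a b d p P q Q x :
  \sum_k pd k (pd k (wave a b d p P q Q)) x =
  wave a b d
    ((ip a a - ip b b) * p + 2 * ip a b * q + 2 * (ip a d * P + ip b d * Q))
    ((ip a a - ip b b) * P + 2 * ip a b * Q)
    ((ip a a - ip b b) * q - 2 * ip a b * p + 2 * (ip a d * Q - ip b d * P))
    ((ip a a - ip b b) * Q - 2 * ip a b * P) x.
Proof.
under eq_bigr => k _ do rewrite pd_wave pd_wave.
by rewrite sum_wave /ip !big_ord_recl !big_ord0; congr (wave _ _ _ _ _ _ _ _); ring.
Qed.

Lemma grad_div_wave a b d (p P q Q : 'I_3 -> R) i x (p' P' q' Q' : R) :
  (forall y, \sum_k pd k (wave a b d (p k) (P k) (q k) (Q k)) y =
     wave a b d p' P' q' Q' y) ->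
  \sum_k pd i (pd k (wave a b d (p k) (P k) (q k) (Q k))) x =
  pd i (wave a b d p' P' q' Q') x.
Proof.
move=> /funext <-.
have -> : (fun y => \sum_k pd k (wave a b d (p k) (P k) (q k) (Q k)) y) = wave a b d
    (\sum_k (a k * p k + b k * q k + d k * P k)) (\sum_k (a k * P k + b k * Q k))
    (\sum_k (a k * q k - b k * p k + d k * Q k)) (\sum_k (a k * Q k - b k * P k)).
  by apply/funext => y; rewrite -sum_wave; apply: eq_bigr => k _; rewrite pd_wave.
rewrite pd_wave.
under eq_bigr => k _ do rewrite pd_wave pd_wave.
by rewrite sum_wave !big_ord_recl !big_ord0; congr (wave _ _ _ _ _ _ _ _); ring.
Qed.

Section null.
Variables a b d : 'I_3 -> R.
Hypotheses (aabb : ip a a = ip b b) (ab0 : ip a b = 0).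

(** The gradient of the harmonic function [wave a b d p 0 q 0]. *)
Definition gradient_field p q : 'I_3 -> space3 R -> R := fun j =>
  wave a b d (a j * p + b j * q) 0 (a j * q - b j * p) 0.

(** With the harmonic function [h = wave a b d p 0 q 0] this is
    [(lambda + 3 mu) h d - (lambda + mu) (d . x) grad h], where the two constants
    make [mu] times the Laplacian of the second term cancel [lambda + mu] times the
    gradient of the divergence. *)
Definition papkovich_field (lambda mu : R) p q : 'I_3 -> space3 R -> R := fun j =>
  wave a b d ((lambda + 3 * mu) * d j * p) (- (lambda + mu) * (a j * p + b j * q))
             ((lambda + 3 * mu) * d j * q) (- (lambda + mu) * (a j * q - b j * p)).

Lemma div_gradient_field p q x : \sum_k pd k (gradient_field p q k) x = wave a b d 0 0 0 0 x.
Proof.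
under eq_bigr => k _ do rewrite pd_wave.
rewrite sum_wave; congr (wave _ _ _ _ _ _ _ _).
- transitivity ((ip a a - ip b b) * p + 2 * ip a b * q); last by rewrite aabb ab0; ring.
  by rewrite /ip !big_ord_recl !big_ord0; ring.
- by rewrite !big_ord_recl !big_ord0; ring.
- transitivity ((ip a a - ip b b) * q - 2 * ip a b * p); last by rewrite aabb ab0; ring.
  by rewrite /ip !big_ord_recl !big_ord0; ring.
- by rewrite !big_ord_recl !big_ord0; ring.
Qed.

Lemma lame_gradient_field lambda mu p q : lame_field lambda mu (gradient_field p q).
Proof.
split=> [j|i x]; first exact: smooth_wave.
refine (etrans (congr2 (fun u v => mu * u + (lambda + mu) * v)
  (laplacian_wave a b d _ _ _ _ x)
  (grad_div_wave i x (div_gradient_field p q))) _).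
rewrite pd_wave lin_wave aabb ab0.
by rewrite -[RHS](wave0 a b d x); congr (wave _ _ _ _ _ _ _ _); ring.
Qed.

Lemma div_papkovich_field lambda mu p q x :
  \sum_k pd k (papkovich_field lambda mu p q k) x =
  wave a b d (2 * mu * (ip a d * p + ip b d * q)) 0 (2 * mu * (ip a d * q - ip b d * p)) 0 x.
Proof.
under eq_bigr => k _ do rewrite pd_wave.
rewrite sum_wave; congr (wave _ _ _ _ _ _ _ _).
- by rewrite /ip !big_ord_recl !big_ord0; ring.
- transitivity (- (lambda + mu) * ((ip a a - ip b b) * p + 2 * ip a b * q));
    last by rewrite aabb ab0; ring.
  by rewrite /ip !big_ord_recl !big_ord0; ring.
- by rewrite /ip !big_ord_recl !big_ord0; ring.
- transitivity (- (lambda + mu) * ((ip a a - ip b b) * q - 2 * ip a b * p));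
    last by rewrite aabb ab0; ring.
  by rewrite /ip !big_ord_recl !big_ord0; ring.
Qed.

Lemma lame_papkovich_field lambda mu p q : lame_field lambda mu (papkovich_field lambda mu p q).
Proof.
split=> [j|i x]; first exact: smooth_wave.
refine (etrans (congr2 (fun u v => mu * u + (lambda + mu) * v)
  (laplacian_wave a b d _ _ _ _ x)
  (grad_div_wave i x (div_papkovich_field lambda mu p q))) _).
rewrite pd_wave lin_wave aabb ab0.
by rewrite -[RHS](wave0 a b d x); congr (wave _ _ _ _ _ _ _ _); ring.
Qed.
End null.
End waves.

(** * Transversely isotropic tensors *)

Section sum4.
Variables (R : comNzRingType) (n : nat).
Local Notation I := 'I_n.

Definition sum4 (F : I -> I -> I -> I -> R) : R :=
  \sum_i \sum_j \sum_k \sum_l F i j k l.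

(** Four sums are merged into one, so that two fourfold sums can be exchanged in a
    single step. *)
Lemma sum4_pair F : sum4 F =
  \sum_(u : I * I * (I * I)) F u.1.1 u.1.2 u.2.1 u.2.2.
Proof.
rewrite /sum4 pair_bigA /= -(pair_bigA _ (fun (u v : I * I) => F u.1 u.2 v.1 v.2)) /=.
by apply: eq_bigr => u _; rewrite pair_bigA.
Qed.

Lemma eq_sum4 F G : (forall i j k l, F i j k l = G i j k l) -> sum4 F = sum4 G.
Proof.
by move=> FG; rewrite !sum4_pair; apply: eq_bigr => u _.
Qed.

Lemma sum4_exchange (F : I -> I -> I -> I -> I -> I -> I -> I -> R) :
  sum4 (fun i j k l => sum4 (fun p q r s => F i j k l p q r s)) =
  sum4 (fun p q r s => sum4 (fun i j k l => F i j k l p q r s)).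
Proof.
rewrite !sum4_pair; under eq_bigr do rewrite sum4_pair.
by rewrite exchange_big; apply: eq_bigr => v _; rewrite sum4_pair.
Qed.

Lemma sum4_distrl c F : c * sum4 F = sum4 (fun i j k l => c * F i j k l).
Proof. by rewrite !sum4_pair mulr_sumr. Qed.

Lemma sum4_distrr c F : sum4 F * c = sum4 (fun i j k l => F i j k l * c).
Proof. by rewrite !sum4_pair mulr_suml. Qed.

Lemma sum4_mul2 (A B : I -> I -> R) : sum4 (fun i j k l => A i j * B k l) =
  (\sum_i \sum_j A i j) * (\sum_k \sum_l B k l).
Proof.
rewrite mulr_suml; apply: eq_bigr => i _; rewrite mulr_suml; apply: eq_bigr => j _.
by rewrite mulr_sumr; apply: eq_bigr => k _; rewrite mulr_sumr.
Qed.

Lemma sum4_mul (a b c d : I -> R) : sum4 (fun i j k l => a i * b j * (c k * d l)) =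
  (\sum_i a i) * (\sum_j b j) * ((\sum_k c k) * (\sum_l d l)).
Proof.
rewrite sum4_mul2; congr (_ * _); rewrite mulr_suml; apply: eq_bigr => i _;
by rewrite mulr_sumr.
Qed.
End sum4.

Section rotate.
Variable (R : comNzRingType) (n : nat).
Local Notation I := 'I_n.
Local Notation tensor := (I -> I -> I -> I -> R).
Implicit Types (C : tensor) (Q T : 'M[R]_n) (M N : I -> I -> R).

(** The change of basis in the definition of invariance of a fourth-order
    tensor. *)
Definition rotate Q C : tensor := fun i j k l =>
  \sum_p \sum_q \sum_r \sum_s Q i p * Q j q * Q k r * Q l s * C p q r s.

Lemma rotate_sum4 Q C i j k l : rotate Q C i j k l =
  sum4 (fun p q r s => Q i p * Q j q * Q k r * Q l s * C p q r s).
Proof. by []. Qed.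

Lemma rotateE Q C i j k l : rotate Q C i j k l =
  \sum_p Q i p * \sum_q Q j q * \sum_r Q k r * \sum_s Q l s * C p q r s.
Proof.
rewrite /rotate; apply: eq_bigr => p _; rewrite big_distrr /=.
apply: eq_bigr => q _; rewrite !big_distrr /=.
apply: eq_bigr => r _; rewrite !big_distrr /=.
by apply: eq_bigr => s _; ring.
Qed.

Lemma rotateM Q T C i j k l : rotate (Q *m T) C i j k l = rotate Q (rotate T C) i j k l.
Proof.
transitivity (sum4 (fun p' q' r' s' => sum4 (fun p q r s =>
    Q i p * T p p' * (Q j q * T q q') * (Q k r * T r r' * (Q l s * T s s')) * C p' q' r' s'))).
  by apply: eq_sum4 => p' q' r' s'; rewrite -sum4_distrr sum4_mul !mxE; ring.
rewrite sum4_exchange.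
transitivity (sum4 (fun p q r s => Q i p * Q j q * Q k r * Q l s * rotate T C p q r s));
  last by [].
apply: eq_sum4 => p q r s.
rewrite rotate_sum4 sum4_distrl.
by apply: eq_sum4 => p' q' r' s'; ring.
Qed.

Lemma rotate_diag (v : 'rV[R]_n) C i j k l : rotate (diag_mx v) C i j k l =
  v 0 i * v 0 j * v 0 k * v 0 l * C i j k l.
Proof.
have D (m : I) (f : I -> R) : \sum_p diag_mx v m p * f p = v 0 m * f m.
  rewrite (bigD1 m)//= mxE eqxx mulr1n big1 ?addr0// => p /negbTE pm.
  by rewrite mxE eq_sym pm mulr0n mul0r.
by rewrite rotateE D D D D; ring.
Qed.

Lemma rotate1 C i j k l : rotate 1%:M C i j k l = C i j k l.
Proof. by rewrite -diag_const_mx rotate_diag !mxE !mul1r. Qed.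

Lemma eq_rotate Q C C' : (forall i j k l, C i j k l = C' i j k l) ->
  forall i j k l, rotate Q C i j k l = rotate Q C' i j k l.
Proof. by move=> CC i j k l; apply: eq_sum4 => p q r s; rewrite CC. Qed.

Definition double_contraction C M N : R :=
  \sum_i \sum_j \sum_k \sum_l C i j k l * M i j * N k l.

Definition pullback T M : I -> I -> R := fun p q => \sum_i \sum_j T i p * T j q * M i j.

(** Change of basis is adjoint to pulling back the two matrices. *)
Lemma double_contraction_rotate T C M N :
  double_contraction (rotate T C) M N = double_contraction C (pullback T M) (pullback T N).
Proof.
transitivity (sum4 (fun i j k l => sum4 (fun p q r s =>
   (C p q r s * ((T i p * T j q * M i j) * (T k r * T l s * N k l)))))).
  apply: eq_sum4 => i j k l; rewrite rotate_sum4 !sum4_distrr.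
  by apply: eq_sum4 => p q r s; ring.
rewrite sum4_exchange; apply: eq_sum4 => p q r s.
by rewrite -sum4_distrl sum4_mul2 mulrA.
Qed.
End rotate.

Section transverse.
Variable R : realFieldType.
Local Notation I := 'I_3.
Local Notation tensor := (I -> I -> I -> I -> R).
Implicit Types (C : tensor) (Q T : 'M[R]_3).

Definition i0 : I := ord0.
Definition i1 : I := lift ord0 ord0.
Definition i2 : I := lift ord0 (lift ord0 ord0).

Definition perp (i j : I) : R := ((i == j) && (i != i2))%:R.
Definition axial (i j : I) : R := ((i == i2) && (j == i2))%:R.

(** The five parameters are the entries with indices [1122], [1212], [1133],
    [3333] and [1313], numbered from one. *)
Definition TI_tensor (h12 h66 h13 h33 h44 : R) : tensor := fun i j k l =>
  h12 * (perp i j * perp k l) + h66 * (perp i k * perp j l + perp i l * perp j k) +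
  h13 * (perp i j * axial k l + axial i j * perp k l) + h33 * (axial i j * axial k l) +
  h44 * (perp i k * axial j l + perp i l * axial j k +
         perp j k * axial i l + perp j l * axial i k).

Definition axis_rotation (c s : R) : 'M[R]_3 :=
  \matrix_(i, j) (nth [::] [:: [:: c; - s; 0]; [:: s; c; 0]; [:: 0; 0; 1]] i)`_j.

Definition axis_reflection (k : I) : 'M[R]_3 :=
  diag_mx (\row_j (if j == k then -1 else 1)).

(** Reflections kill the entries in which some index occurs an odd number of
    times, the quarter turn identifies the two transverse directions, and one more
    turn, by an angle whose cosine and sine are nonzero, relates [C1111] to
    [C1122] and [C1212]. *)
Lemma TI_tensorP C c s : c * s != 0 -> c ^+ 2 + s ^+ 2 = 1 ->
  (forall i j k l, C i j k l = C j i k l) ->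
  (forall i j k l, C i j k l = C k l i j) ->
  (forall r i j k l, rotate (axis_reflection r) C i j k l = C i j k l) ->
  (forall i j k l, rotate (axis_rotation 0 1) C i j k l = C i j k l) ->
  (forall i j k l, rotate (axis_rotation c s) C i j k l = C i j k l) ->
  forall i j k l, C i j k l = TI_tensor (C i0 i0 i1 i1) (C i0 i1 i0 i1)
    (C i0 i0 i2 i2) (C i2 i2 i2 i2) (C i0 i2 i0 i2) i j k l.
Proof.
move=> cs0 cs1 minor major refl quarter turn.
have odd0 r i j k l : odd ((i == r) + (j == r) + (k == r) + (l == r)) -> C i j k l = 0.
  have := refl r i j k l; rewrite rotate_diag !mxE.
  case: (i == r); case: (j == r); case: (k == r); case: (l == r) => //= h _; nra.
have minor' i j k l : C i j k l = C i j l k by rewrite major minor major.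
have q i j k l : C i j k l = \sum_p axis_rotation 0 1 i p * \sum_q axis_rotation 0 1 j q *
    \sum_r axis_rotation 0 1 k r * \sum_s axis_rotation 0 1 l s * C p q r s.
  by rewrite -rotateE quarter.
have s0 (f : I -> R) : \sum_p axis_rotation 0 1 i0 p * f p = - f i1.
  by rewrite !big_ord_recl big_ord0 !mxE /= !mul0r mulN1r add0r !addr0.
have s1 (f : I -> R) : \sum_p axis_rotation 0 1 i1 p * f p = f i0.
  by rewrite !big_ord_recl big_ord0 !mxE /= !mul0r mul1r !addr0.
have s2 (f : I -> R) : \sum_p axis_rotation 0 1 i2 p * f p = f i2.
  by rewrite !big_ord_recl big_ord0 !mxE /= !mul0r mul1r !add0r addr0.
have e1111 : C i1 i1 i1 i1 = C i0 i0 i0 i0 by rewrite [RHS]q !s0 !opprK.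
have e1122 : C i1 i1 i2 i2 = C i0 i0 i2 i2 by rewrite [RHS]q !s0 !s2 opprK.
have e1212 : C i1 i2 i1 i2 = C i0 i2 i0 i2 by rewrite [RHS]q !(s0, s2) opprK.
have t0 (f : I -> R) : \sum_p axis_rotation c s i0 p * f p = c * f i0 - s * f i1.
  by rewrite !big_ord_recl big_ord0 !mxE /= mul0r !addr0 mulNr.
have e0000 : C i0 i0 i0 i0 = C i0 i0 i1 i1 + 2 * C i0 i1 i0 i1.
  have := turn i0 i0 i0 i0; rewrite rotateE !t0.
  rewrite !(odd0 i0 i0 i0 i0 i1) ?(odd0 i0 i0 i0 i1 i0) ?(odd0 i0 i0 i1 i0 i0) ?(odd0 i0 i1 i0 i0 i0)//.
  rewrite !(odd0 i0 i1 i1 i1 i0) ?(odd0 i0 i1 i1 i0 i1) ?(odd0 i0 i1 i0 i1 i1) ?(odd0 i0 i0 i1 i1 i1)//.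
  rewrite e1111 (major i1 i1 i0 i0) (minor i1 i0 i0 i1) (minor i1 i0 i1 i0) (minor' i0 i1 i1 i0) => h.
  have c2 : c ^+ 2 = 1 - s ^+ 2 by rewrite -cs1; ring.
  have : 2 * (c * s) ^+ 2 * (C i0 i0 i0 i0 - (C i0 i0 i1 i1 + 2 * C i0 i1 i0 i1)) = 0.
    move: h; move: (C i0 i0 i0 i0) (C i0 i0 i1 i1) (C i0 i1 i0 i1) => x y z h.
    have -> : 2 * (c * s) ^+ 2 * (x - (y + 2 * z)) =
      x * ((c ^+ 2 + s ^+ 2) ^+ 2 - 1) - ((c ^+ 2) ^+ 2 * x + (s ^+ 2) ^+ 2 * x +
        c ^+ 2 * s ^+ 2 * (2 * y + 4 * z) - x) by ring.
    rewrite cs1 expr1n subrr mulr0 sub0r; apply/eqP; rewrite oppr_eq0; apply/eqP.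
    move/eqP: h; rewrite -subr_eq0 => /eqP h; apply: etrans h; ring.
  move=> /eqP; rewrite mulf_eq0 mulf_eq0 expf_eq0 /= (negbTE cs0) pnatr_eq0 /=.
  by rewrite subr_eq0 => /eqP.
have v := (e0000, e1111, e1122, e1212, minor' i0 i1 i1 i0, minor i1 i0 i0 i1,
  minor i1 i0 i1 i0, major i1 i1 i0 i0, minor' i0 i2 i2 i0, minor i2 i0 i0 i2,
  minor i2 i0 i2 i0, minor' i1 i2 i2 i1, minor i2 i1 i1 i2, minor i2 i1 i2 i1,
  major i2 i2 i0 i0, major i2 i2 i1 i1).
move=> i j k l.
have I3 (m : I) : [\/ m = i0, m = i1 | m = i2].
  by case: m => -[|[|[|//]]] ?; [apply: Or31|apply: Or32|apply: Or33]; exact: val_inj.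
rewrite /TI_tensor /perp /axial.
case: (I3 i) => ->; case: (I3 j) => ->; case: (I3 k) => ->; case: (I3 l) => ->;
  rewrite /= ?(mulr0, mulr1, mul0r, addr0, add0r).
all: try by rewrite (odd0 i0).
all: try by rewrite (odd0 i1).
all: rewrite ?v; ring.
Qed.

Lemma double_contraction_TI h12 h66 h13 h33 h44 (M N : I -> I -> R) :
  double_contraction (TI_tensor h12 h66 h13 h33 h44) M N =
  h12 * ((M i0 i0 + M i1 i1) * (N i0 i0 + N i1 i1)) +
  h66 * (2 * M i0 i0 * N i0 i0 + 2 * M i1 i1 * N i1 i1 +
         (M i0 i1 + M i1 i0) * (N i0 i1 + N i1 i0)) +
  h13 * ((M i0 i0 + M i1 i1) * N i2 i2 + M i2 i2 * (N i0 i0 + N i1 i1)) +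
  h33 * (M i2 i2 * N i2 i2) +
  h44 * ((M i0 i2 + M i2 i0) * (N i0 i2 + N i2 i0) +
         (M i1 i2 + M i2 i1) * (N i1 i2 + N i2 i1)).
Proof.
rewrite /double_contraction !big_ord_recl !big_ord0 /TI_tensor /perp /axial /=.
rewrite -/i0 -/i1 -/i2 /= ?(mulr0, mulr1, mul0r, addr0, add0r).
ring.
Qed.
End transverse.

Section rotate_symmetries.
Variables (R : comNzRingType) (n : nat).
Local Notation tensor := ('I_n -> 'I_n -> 'I_n -> 'I_n -> R).
Implicit Types (C : tensor) (Q T : 'M[R]_n).

Lemma sum4_swap (F : tensor) : sum4 F = sum4 (fun i j k l => F j i k l).
Proof. by rewrite /sum4 exchange_big. Qed.

Lemma sum4_swap_pairs (F : tensor) : sum4 F = sum4 (fun i j k l => F k l i j).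
Proof.
rewrite !sum4_pair -(pair_bigA _ (fun (u v : 'I_n * 'I_n) => F u.1 u.2 v.1 v.2)) exchange_big /=.
by rewrite pair_bigA.
Qed.

Lemma rotate_minor Q C : (forall i j k l, C i j k l = C j i k l) ->
  forall i j k l, rotate Q C i j k l = rotate Q C j i k l.
Proof.
move=> minor i j k l; rewrite !rotate_sum4 sum4_swap; apply: eq_sum4 => p q r s.
by rewrite minor; ring.
Qed.

Lemma rotate_major Q C : (forall i j k l, C i j k l = C k l i j) ->
  forall i j k l, rotate Q C i j k l = rotate Q C k l i j.
Proof.
move=> major i j k l; rewrite !rotate_sum4 sum4_swap_pairs; apply: eq_sum4 => p q r s.
by rewrite major; ring.
Qed.

Lemma rotate_conj Q T C : T^T *m T = 1%:M ->
  (forall i j k l, rotate (T *m Q *m T^T) C i j k l = C i j k l) ->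
  forall i j k l, rotate Q (rotate T^T C) i j k l = rotate T^T C i j k l.
Proof.
move=> TT inv i j k l; rewrite -rotateM -[RHS](eq_rotate _ inv) -rotateM.
by rewrite !mulmxA TT mul1mx.
Qed.

Lemma rotateK T C : T^T *m T = 1%:M ->
  forall i j k l, rotate T (rotate T^T C) i j k l = C i j k l.
Proof. by move=> /mulmx1C TT i j k l; rewrite -rotateM TT rotate1. Qed.
End rotate_symmetries.

Section transverse_isotropy.
Variable R : realType.
Local Notation tensor := ('I_3 -> 'I_3 -> 'I_3 -> 'I_3 -> R).
Implicit Types (C : tensor) (T : 'M[R]_3).

(** The turn by [pi / 4] is the generic one. *)
Lemma frame_TI_tensor C T : T^T *m T = 1%:M ->
  (forall i j k l, C i j k l = C j i k l) ->
  (forall i j k l, C i j k l = C k l i j) ->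
  (forall Q, TI_group Q -> tensor_invariant (T *m Q *m T^T) C) ->
  let c := rotate T^T C in
  forall i j k l, c i j k l = TI_tensor (c i0 i0 i1 i1) (c i0 i1 i0 i1)
    (c i0 i0 i2 i2) (c i2 i2 i2 i2) (c i0 i2 i0 i2) i j k l.
Proof.
move=> TT minor major inv c.
have cinv Q : TI_group Q -> forall i j k l, rotate Q c i j k l = c i j k l.
  by move=> /inv QC; apply: rotate_conj.
have pi0 := pi_gt0 R.
have rot (t : R) : 0 <= t <= 2 * pi -> TI_group (axis_rotation (cos t) (sin t)).
  by move=> ht; right; exists t.
apply: (@TI_tensorP _ c (cos (pi / 4)) (sin (pi / 4))).
- by rewrite mulf_neq0// gt_eqF// ?cos_gt0_pihalf ?sin_gt0_pi//; apply/andP; split; lra.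
- exact: cos2Dsin2.
- exact: rotate_minor.
- exact: rotate_major.
- by move=> r; apply: cinv; left; exists r.
- have : TI_group (axis_rotation (cos (pi / 2)) (sin (pi / 2)) : 'M[R]_3).
    by apply: rot; apply/andP; split; lra.
  by rewrite cos_pihalf sin_pihalf => /cinv.
- by apply: cinv; apply: rot; apply/andP; split; lra.
Qed.

Lemma double_contraction_frame C T (M N : 'I_3 -> 'I_3 -> R) : T^T *m T = 1%:M ->
  double_contraction C M N = double_contraction (rotate T^T C) (pullback T M) (pullback T N).
Proof.
move=> TT; rewrite -double_contraction_rotate /double_contraction.
by do 4 (apply: eq_bigr => ? _); rewrite rotateK.
Qed.

End transverse_isotropy.

(** * Integrability of the moduli *)

Section bounded_coefficients.
Variables (R : realType) (Omega : set (space3 R)).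
Hypotheses (oO : open Omega) (bO : bounded_set Omega).
Local Notation mu3 := (@lebesgue3 R).
Local Notation integrable_on f := (mu3.-integrable (Omega : set (mspace3 R)) (EFin \o (f : space3 R -> R))).
Let mO : measurable (Omega : set (mspace3 R)). Proof. exact: open_measurable3. Qed.

Lemma lebesgue3_bounded : (mu3 Omega < +oo)%E.
Proof.
have [M _ UM] := bounded_box3 bO; apply: le_lt_trans (lebesgue3_box3 M).
by apply: le_measure => //; rewrite inE//; exact: measurable_box3.
Qed.

(** The domain has finite measure. *)
Lemma Linfty_integrable w : inLp Omega +oo%E w -> integrable_on w.
Proof.
move=> /andP[]; rewrite !inE /= => mw; rewrite /finite_norm unlock => nw.
have mwO : measurable_fun (Omega : set (mspace3 R)) w.
  exact/(measurable_restrictT _ _).2.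
have [M M0 wM] : exists2 M : R, 0 <= M &
    {ae mu3, forall x : mspace3 R, Omega x -> (`|(w x)%:E| <= M%:E)%E}.
  move: nw; case: ifPn => [_ nw|]; last first.
    rewrite -leNgt => m0 _; exists 0 => //.
    exists setT; split=> //.
    by apply/eqP; rewrite eq_le m0 measure_ge0.
  exists `|fine (ess_sup mu3 (abse \o (EFin \o (w \_ Omega))))| => //.
  have := ess_sup_ge mu3 (abse \o (EFin \o (w \_ Omega))).
  apply: filterS => x /= h Ox; move: h; rewrite patchE mem_set//.
  move: nw; case: (ess_sup _ _) => [r _|//|_] /=.
    by move=> /le_trans; apply; rewrite lee_fin ler_norm.
  by rewrite leeNy_eq.
apply/integrableP; split; first exact/measurable_EFinP.
apply: (@le_lt_trans _ _ (\int[mu3]_(x in Omega) (cst M%:E x))%E).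
  apply: ae_ge0_le_integral => //.
  - by apply: measurableT_comp => //; exact/measurable_EFinP.
by rewrite integral_cst// lte_mul_pinfty// lebesgue3_bounded.
Qed.

Lemma integrable_sum_ord n (F : 'I_n -> space3 R -> R) :
  (forall i, integrable_on (F i)) -> integrable_on (fun x => \sum_i F i x).
Proof.
move=> iF; have -> : EFin \o (fun x => \sum_i F i x) = (fun x => \sum_i (F i x)%:E)%E.
  by apply/funext => x; rewrite /= sumEFin.
by apply: integrable_sum => // i _; exact: iF.
Qed.

Lemma integrable_mul_continuous w g : integrable_on w -> continuous g ->
  integrable_on (fun x => w x * g x).
Proof.
move=> iw cg; have [M M0 gM] := continuous_bounded3 cg bO.
apply: (@integrableMl _ _ _ mu3 Omega mO (EFin \o w) g) => //.
  by apply: measurable_funTS; exact: continuous_measurable3.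
exists M; split=> [|N MN x Ox]; first exact: num_real.
by apply: (le_trans (gM _ Ox)); exact: ltW.
Qed.

Lemma integrable_add w g : integrable_on w -> integrable_on g ->
  integrable_on (fun x => w x + g x).
Proof. by move=> iw ig; exact: (integrableD mO iw ig). Qed.

Lemma integrable_scale (c : R) w : integrable_on w -> integrable_on (fun x => c * w x).
Proof. by move=> iw; exact: (integrableZl mO c iw). Qed.

Lemma eq_Rintegral_ae w g : integrable_on w -> integrable_on g ->
  {ae mu3, forall x : mspace3 R, Omega x -> w x = g x} ->
  \int[mu3]_(x in Omega) w x = \int[mu3]_(x in Omega) g x.
Proof.
move=> iw ig wg; rewrite /Rintegral; congr fine; apply: ae_eq_integral => //.
- exact: measurable_int iw.
- exact: measurable_int ig.
- by apply: filterS wg => x /= h Ox; rewrite h.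
Qed.
End bounded_coefficients.

(** * Contractions with null dyads *)

Section frames.
Variables (R : realType) (T : 'M[R]_3).
Hypothesis TT : T^T *m T = 1%:M.
Implicit Types (u v a b : 'I_3 -> R) (M N : 'I_3 -> 'I_3 -> R).

Definition out_frame u : 'I_3 -> R := fun i => \sum_p T i p * u p.
Definition in_frame u : 'I_3 -> R := fun p => \sum_i T i p * u i.

Lemma frame_orthonormal p q : \sum_i T i p * T i q = (p == q)%:R.
Proof.
by have /matrixP/(_ p q) := TT; rewrite !mxE => <-; apply: eq_bigr => i _; rewrite mxE.
Qed.

Lemma frame_complete i j : \sum_p T i p * T j p = (i == j)%:R.
Proof.
by have /matrixP/(_ i j) := mulmx1C TT; rewrite !mxE => <-; apply: eq_bigr => p _; rewrite mxE.
Qed.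

Lemma sum_eq_delta (f : 'I_3 -> R) p : \sum_q (p == q)%:R * f q = f p.
Proof.
rewrite (bigD1 p)//= eqxx mul1r big1 ?addr0// => q /negbTE.
by rewrite eq_sym => ->; rewrite mul0r.
Qed.

Lemma out_frameK u p : in_frame (out_frame u) p = u p.
Proof.
rewrite -[RHS]sum_eq_delta; under [RHS]eq_bigr do rewrite -frame_orthonormal.
by rewrite /in_frame /out_frame !big_ord_recl !big_ord0; ring.
Qed.

Lemma in_frameK u i : out_frame (in_frame u) i = u i.
Proof.
rewrite -[RHS]sum_eq_delta; under [RHS]eq_bigr do rewrite -frame_complete.
by rewrite /in_frame /out_frame !big_ord_recl !big_ord0; ring.
Qed.

Lemma ip_out_frame u v : ip (out_frame u) (out_frame v) = ip u v.
Proof.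
transitivity (\sum_p u p * in_frame (out_frame v) p); last first.
  by apply: eq_bigr => p _; rewrite out_frameK.
by rewrite /ip /in_frame /out_frame !big_ord_recl !big_ord0; ring.
Qed.

Lemma pullback_trace M : pullback T M i0 i0 + pullback T M i1 i1 + pullback T M i2 i2 =
  \sum_i M i i.
Proof.
transitivity (\sum_i \sum_j (i == j)%:R * M i j); last first.
  by apply: eq_bigr => i _; rewrite sum_eq_delta.
under [RHS]eq_bigr do under eq_bigr do rewrite -frame_complete.
by rewrite /pullback /i0 /i1 /i2 !big_ord_recl !big_ord0; ring.
Qed.

(** The real part of [(C - i S) z_i z_j] for [z = a + i b]: up to the factor
    [expR (dot a x)], the Hessian of the real part of a multiple of
    [exp (z . x)]. *)
Definition null_dyad a b (C S : R) : 'I_3 -> 'I_3 -> R := fun i j =>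
  C * (a i * a j - b i * b j) + S * (a i * b j + b i * a j).

Lemma pullback_null_dyad a b C S p q :
  pullback T (null_dyad a b C S) p q = null_dyad (in_frame a) (in_frame b) C S p q.
Proof. by rewrite /pullback /null_dyad /in_frame !big_ord_recl !big_ord0; ring. Qed.
End frames.

Section pointwise.
Variable R : realType.
Implicit Types (a b d : 'I_3 -> R) (M N : 'I_3 -> 'I_3 -> R) (h C S : R).

(** The sum over the two dyads is the Hermitian form of the tensor at the complex
    matrix [z_i z_j], so that only the moduli of the components of [z] remain.
    As [z . z = 0], the transverse part of the trace is minus the axial entry. *)
Lemma double_contraction_null_dyad h12 h66 h13 h33 h44 a b C S :
  C ^+ 2 + S ^+ 2 = 1 -> ip a a = ip b b -> ip a b = 0 ->
  let X := a i2 ^+ 2 + b i2 ^+ 2 in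
  let Y := a i0 ^+ 2 + a i1 ^+ 2 + b i0 ^+ 2 + b i1 ^+ 2 in
  double_contraction (TI_tensor h12 h66 h13 h33 h44)
    (null_dyad a b C (- S)) (null_dyad a b C (- S)) +
  double_contraction (TI_tensor h12 h66 h13 h33 h44)
    (null_dyad a b S C) (null_dyad a b S C) =
  (h12 - 2 * h13 + h33) * X ^+ 2 + 2 * h66 * Y ^+ 2 + 4 * h44 * (X * Y).
Proof.
move=> CS aabb ab X Y; rewrite !double_contraction_TI.
have tr u v : null_dyad a b u v i0 i0 + null_dyad a b u v i1 i1 = - null_dyad a b u v i2 i2.
  apply/eqP; rewrite -addr_eq0; apply/eqP.
  transitivity (u * (ip a a - ip b b) + v * (2 * ip a b)); last by rewrite aabb ab; ring.
  by rewrite /null_dyad /ip /i0 /i1 /i2 !big_ord_recl !big_ord0; ring.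
rewrite !tr /null_dyad -[RHS]mul1r -[X in _ = X * _]CS /X /Y; ring.
Qed.

(** Once [h66], [h44] and [h12 - 2 h13 + h33] vanish, the form factors through the
    trace and the axial entry. *)
Lemma double_contraction_trace h12 h13 M N :
  double_contraction (TI_tensor h12 0 h13 (2 * h13 - h12) 0) M N =
  (h13 - h12) * ((M i0 i0 + M i1 i1 + M i2 i2) * N i2 i2 +
                 M i2 i2 * (N i0 i0 + N i1 i1 + N i2 i2)) +
  h12 * ((M i0 i0 + M i1 i1 + M i2 i2) * (N i0 i0 + N i1 i1 + N i2 i2)).
Proof. by rewrite double_contraction_TI; ring. Qed.

Lemma pd_gradient_field a b d p q i j x : pd i (gradient_field a b d p q j) x =
  null_dyad a b (expR (dot a x) * (p * cos (dot b x) + q * sin (dot b x)))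
                (expR (dot a x) * (q * cos (dot b x) - p * sin (dot b x))) i j.
Proof. by rewrite /gradient_field pd_wave /wave /null_dyad; ring. Qed.

(** On the line [X + Y = 2 (u + v)] the form is a quadratic polynomial in [X],
    which is determined by three values. *)
Lemma quadratic_form_line_eq0 (A B D u v : R) : 0 < v -> 0 <= u ->
  (forall s, s \in [:: 0; 1; 16 / 25] ->
     let X := u + s * v in let Y := 2 * (u + v) - X in
     A * X ^+ 2 + B * Y ^+ 2 + D * (X * Y) = 0) ->
  [/\ A = 0, B = 0 & D = 0].
Proof.
move=> v0 u0 H.
have h0 := H 0 ltac:(by rewrite !inE eqxx).
have h1 := H 1 ltac:(by rewrite !inE eqxx ?orbT).
have h2 := H (16 / 25) ltac:(by rewrite !inE eqxx ?orbT).
have vN0 : v != 0 by rewrite gt_eqF.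
pose m := 2 * (u + v); have mN0 : m != 0 by rewrite gt_eqF// mulr_gt0// ltr_wpDl.
pose al := A + B - D; pose be := m * (D - 2 * B).
have e1 : al * (2 * u + v) + be = 0.
  apply: (mulfI vN0); rewrite mulr0 -[RHS](subrr (0 : R)) -{1}h1 -h0 /al /be /m; ring.
have e2 : al * (2 * u + 16 / 25 * v) + be = 0.
  have cN0 : 16 / 25 * v != 0 by rewrite mulf_neq0// mulf_neq0// ?invr_eq0 pnatr_eq0.
  apply: (mulfI cN0); rewrite mulr0 -[RHS](subrr (0 : R)) -{1}h2 -h0 /al /be /m.
  by field.
have al0 : al = 0.
  apply: (mulIf vN0); rewrite mul0r.
  transitivity (25 / 9 * ((al * (2 * u + v) + be) - (al * (2 * u + 16 / 25 * v) + be))).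
    by field.
  by rewrite e1 e2 subrr mulr0.
have be0 : be = 0 by move: e1; rewrite al0 mul0r add0r.
have B0 : B = 0.
  apply: (mulIf (expf_neq0 2 mN0)); rewrite mul0r -[RHS]h0.
  transitivity (al * u ^+ 2 + be * u + B * m ^+ 2); first by rewrite al0 be0; ring.
  by rewrite /al /be /m; ring.
have D0 : D = 0 by apply: (mulfI mN0); move: be0; rewrite /be B0; lra.
by split=> //; move: al0; rewrite /al B0 D0; lra.
Qed.
End pointwise.

(** * The moduli vanish *)

Lemma ae_apply2 (R : realType) (P Q S : mspace3 R -> Prop) :
  (forall x, P x -> Q x -> S x) -> {ae @lebesgue3 R, forall x : mspace3 R, P x} ->
  {ae @lebesgue3 R, forall x : mspace3 R, Q x} ->
  {ae @lebesgue3 R, forall x : mspace3 R, S x}.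
Proof. by move=> PQS; apply: filterS2. Qed.

Section inverse_problem.
Variables (R : realType) (Omega : set (space3 R)) (lambda mu : R).
Variables (dC : tensor_field R) (L : vfield R -> vfield R -> R[i]) (T : 'M[R]_3).
Local Notation mu3 := (@lebesgue3 R).
Local Notation integrable_on f := (mu3.-integrable (Omega : set (mspace3 R)) (EFin \o (f : space3 R -> R))).
Local Notation dC_at x := (fun i j k l => dC i j k l x).

Hypotheses (oO : open Omega) (bO : bounded_set Omega) (mu0 : 0 < mu).
Hypotheses (TT : T^T *m T = 1%:M).
Hypothesis dCi : forall i j k l, integrable_on (dC i j k l).
Hypothesis LD : linearized_DtN Omega lambda mu dC L.
Hypothesis L0 : forall f g, H12 Omega f -> H12 Omega g -> L f g = 0.

Definition modulus p q r s : space3 R -> R := fun x => rotate T^T (dC_at x) p q r s.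
Let h12 := modulus i0 i0 i1 i1.
Let h66 := modulus i0 i1 i0 i1.
Let h13 := modulus i0 i0 i2 i2.
Let h33 := modulus i2 i2 i2 i2.
Let h44 := modulus i0 i2 i0 i2.

Definition frame_tensor x := TI_tensor (h12 x) (h66 x) (h13 x) (h33 x) (h44 x).

Hypothesis dC_frame : {ae mu3, forall x : mspace3 R, Omega x ->
  forall p q r s, modulus p q r s x = frame_tensor x p q r s}.

Definition jacobian (U : 'I_3 -> space3 R -> R) x : 'I_3 -> 'I_3 -> R :=
  fun i j => pd i (U j) x.

Definition energy U V x : R := double_contraction (dC_at x) (jacobian U x) (jacobian V x).

Let mO : measurable (Omega : set (mspace3 R)). Proof. exact: open_measurable3. Qed.

Lemma modulus_integrable p q r s : integrable_on (modulus p q r s).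
Proof.
do 4 (apply: integrable_sum_ord => // ?).
exact: integrable_scale.
Qed.

Lemma energy_integrable U V : (forall j, smooth (U j)) -> (forall j, smooth (V j)) ->
  integrable_on (energy U V).
Proof.
move=> sU sV; do 4 (apply: integrable_sum_ord => // ?).
apply: integrable_mul_continuous => //; last exact/smooth_continuous/smooth_pd.
by apply: integrable_mul_continuous => //; exact/smooth_continuous/smooth_pd.
Qed.

Lemma energy_frame : {ae mu3, forall x : mspace3 R, Omega x -> forall U V,
  energy U V x = double_contraction (frame_tensor x)
    (pullback T (jacobian U x)) (pullback T (jacobian V x))}.
Proof.
apply: filterS dC_frame => x h Ox U V.
rewrite /energy (double_contraction_frame _ _ _ TT) /double_contraction.
by do 4 (apply: eq_bigr => ? _); rewrite -h.
Qed.

(** The orthogonality relations are used two at a time, once for the real and once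
    for the imaginary part of a complex exponential. *)
Lemma energy_identity U1 V1 U2 V2 (g : space3 R -> R) :
  lame_field lambda mu U1 -> lame_field lambda mu V1 ->
  lame_field lambda mu U2 -> lame_field lambda mu V2 -> integrable_on g ->
  {ae mu3, forall x : mspace3 R, Omega x -> energy U1 V1 x + energy U2 V2 x = g x} ->
  \int[mu3]_(x in Omega) g x = 0.
Proof.
move=> lU1 lV1 lU2 lV2 ig eg.
have i1 := energy_integrable lU1.1 lV1.1; have i2 := energy_integrable lU2.1 lV2.1.
rewrite -(eq_Rintegral_ae oO (integrable_add oO i1 i2) ig eg) RintegralD//.
have o1 := field_orthogonality oO bO LD L0 lU1 lV1.
have o2 := field_orthogonality oO bO LD L0 lU2 lV2.
by rewrite [X in X + _]o1 [X in _ + X]o2 addr0.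
Qed.

(** The frequencies [2 a] with [a i0 > 0] in the frame fill a half-space that
    contains no multiple of the axis. *)
Lemma laplace_injective_frame g : integrable_on g ->
  (forall a, 0 < a i0 ->
    \int[mu3]_(x in Omega) (g x * expR (dot (fun i => 2 * out_frame T a i) x)) = 0) ->
  {ae mu3, forall x : mspace3 R, Omega x -> g x = 0}.
Proof.
move=> ig g0; pose w i := T i i0.
apply: (@laplace_injective _ _ g w oO bO ig) => [|k kw].
  by rewrite [ltRHS]frame_orthonormal// eqxx.
rewrite -[RHS](g0 (fun p => in_frame T k p / 2)); last first.
  rewrite divr_gt0// /in_frame; move: kw; congr (0 < _).
  by apply: eq_bigr => i _; rewrite mulrC.
apply: eq_Rintegral => x _; congr (_ * expR (dot _ x)); apply/funext => i.
rewrite -[LHS](in_frameK TT) /out_frame mulr_sumr; apply: eq_bigr => p _; by field.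
Qed.

Lemma expR_double (a : 'I_3 -> R) (x : space3 R) :
  expR (dot a x) ^+ 2 = expR (dot (fun i => 2 * a i) x).
Proof. by rewrite dotZl expRM_natl. Qed.

Lemma exp_integrable g (k : 'I_3 -> R) : integrable_on g ->
  integrable_on (fun x => g x * expR (dot k x)).
Proof. by move=> ig; apply: integrable_mul_continuous => //; exact: continuous_expR_dot. Qed.

Lemma combination_integrable (c1 c2 c3 c4 c5 : R) : integrable_on (fun x =>
  c1 * h12 x + c2 * h66 x + c3 * h13 x + c4 * h33 x + c5 * h44 x).
Proof.
have iZ c p q r s : integrable_on (fun x => c * modulus p q r s x).
  by apply: integrable_scale => //; exact: modulus_integrable.
by do 4 (apply: integrable_add => //; last exact: iZ); exact: iZ.
Qed.

Section null_vectors.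
Variables a b : 'I_3 -> R.
Hypotheses (aabb : ip a a = ip b b) (ab0 : ip a b = 0).
Let a' := out_frame T a.
Let b' := out_frame T b.
Let aabb' : ip a' a' = ip b' b'. Proof. by rewrite !ip_out_frame. Qed.
Let ab0' : ip a' b' = 0. Proof. by rewrite ip_out_frame. Qed.
Let d := fun i => T i i2.
Let X := a i2 ^+ 2 + b i2 ^+ 2.
Let Y := a i0 ^+ 2 + a i1 ^+ 2 + b i0 ^+ 2 + b i1 ^+ 2.

Lemma pullback_gradient p q x : pullback T (jacobian (gradient_field a' b' d p q) x) =
  null_dyad a b (expR (dot a' x) * (p * cos (dot b' x) + q * sin (dot b' x)))
                (expR (dot a' x) * (q * cos (dot b' x) - p * sin (dot b' x))).
Proof.
have -> : jacobian (gradient_field a' b' d p q) x = null_dyad a' b'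
    (expR (dot a' x) * (p * cos (dot b' x) + q * sin (dot b' x)))
    (expR (dot a' x) * (q * cos (dot b' x) - p * sin (dot b' x))).
  by apply/funext => i; apply/funext => j; exact: pd_gradient_field.
apply/funext => i; apply/funext => j; rewrite pullback_null_dyad /null_dyad.
by rewrite !out_frameK.
Qed.

Lemma gradient_energy_identity :
  \int[mu3]_(x in Omega) (((h12 x - 2 * h13 x + h33 x) * X ^+ 2 + 2 * h66 x * Y ^+ 2 +
     4 * h44 x * (X * Y)) * expR (dot (fun i => 2 * a' i) x)) = 0.
Proof.
have lg p q : lame_field lambda mu (gradient_field a' b' d p q).
  exact: lame_gradient_field.
apply: (energy_identity (lg 1 0) (lg 1 0) (lg 0 1) (lg 0 1)).
  apply: exp_integrable; move: (combination_integrable (X ^+ 2) (2 * Y ^+ 2) (- 2 * X ^+ 2)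
    (X ^+ 2) (4 * (X * Y))).
  by apply: eq_integrable => // x _ /=; congr (_%:E); ring.
apply: filterS energy_frame => x h Ox; rewrite !h// !pullback_gradient.
rewrite /frame_tensor !mul1r !mul0r !addr0 !add0r ?subr0 ?sub0r.
have dcZ e g1 g2 g3 g4 g5 C S C' S' : double_contraction (TI_tensor g1 g2 g3 g4 g5)
   (null_dyad a b (e * C) (e * S)) (null_dyad a b (e * C') (e * S')) =
   e ^+ 2 * double_contraction (TI_tensor g1 g2 g3 g4 g5)
   (null_dyad a b C S) (null_dyad a b C' S') :> R.
  by rewrite !double_contraction_TI /null_dyad; ring.
rewrite !dcZ -mulrDr double_contraction_null_dyad ?cos2Dsin2// expR_double mulrC //.
Qed.
End null_vectors.

(** The circle of vectors [b] orthogonal to [a] with the length of [a], where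
    [cs] and [sn] are the cosine and the sine of the angle measured from the vector
    of the circle that is orthogonal to the axis. *)
Lemma null_companion (a : 'I_3 -> R) (cs sn : R) : cs ^+ 2 + sn ^+ 2 = 1 -> 0 < a i0 ->
  exists b, [/\ ip a a = ip b b, ip a b = 0 &
                b i2 ^+ 2 = sn ^+ 2 * (a i0 ^+ 2 + a i1 ^+ 2)].
Proof.
move=> cs1 a0.
have v0 : 0 < a i0 ^+ 2 + a i1 ^+ 2 by rewrite ltr_pwDl ?exprn_gt0// sqr_ge0.
pose r := Num.sqrt (a i0 ^+ 2 + a i1 ^+ 2).
pose rho := Num.sqrt (a i0 ^+ 2 + a i1 ^+ 2 + a i2 ^+ 2).
have rN0 : r != 0 by rewrite gt_eqF// sqrtr_gt0.
have r2 : r ^+ 2 = a i0 ^+ 2 + a i1 ^+ 2 by rewrite sqr_sqrtr// ltW.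
have rho2 : rho ^+ 2 = r ^+ 2 + a i2 ^+ 2.
  by rewrite r2 sqr_sqrtr// addr_ge0 ?sqr_ge0// ltW.
pose n0 := a i0 / r; pose n1 := a i1 / r.
have a0E : a i0 = r * n0 by rewrite /n0 mulrCA mulfV ?mulr1.
have a1E : a i1 = r * n1 by rewrite /n1 mulrCA mulfV ?mulr1.
have n1E : n0 ^+ 2 + n1 ^+ 2 = 1.
  by apply: (mulfI (expf_neq0 2 rN0)); rewrite mulr1 [RHS]r2 a0E a1E; ring.
pose b (i : 'I_3) : R := nth 0 [:: - cs * rho * n1 + sn * n0 * a i2;
  cs * rho * n0 + sn * n1 * a i2; - sn * r] i.
exists b; rewrite /ip !big_ord_recl !big_ord0 -/i0 -/i1 -/i2 !addr0.
have [b0 b1 b2] : [/\ b i0 = - cs * rho * n1 + sn * n0 * a i2,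
  b i1 = cs * rho * n0 + sn * n1 * a i2 & b i2 = - sn * r] by [].
rewrite b0 b1 b2 -r2 a0E a1E; split; last by ring.
- transitivity (r ^+ 2 * (n0 ^+ 2 + n1 ^+ 2) + a i2 ^+ 2); first by ring.
  transitivity (cs ^+ 2 * rho ^+ 2 * (n0 ^+ 2 + n1 ^+ 2) +
    sn ^+ 2 * (a i2 ^+ 2 * (n0 ^+ 2 + n1 ^+ 2) + r ^+ 2)); last by ring.
  rewrite n1E rho2 -[LHS]mul1r -[X in X * _ = _]cs1; ring.
- transitivity (sn * r * a i2 * (n0 ^+ 2 + n1 ^+ 2 - 1)); first by ring.
  by rewrite n1E subrr mulr0.
Qed.

Let axis_sum g a := \int[mu3]_(x in Omega) (g x * expR (dot (fun i => 2 * out_frame T a i) x)).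

Lemma transverse_moduli_eq0 (a : 'I_3 -> R) : 0 < a i0 ->
  [/\ axis_sum (fun x => h12 x - 2 * h13 x + h33 x) a = 0,
      axis_sum h66 a = 0 & axis_sum h44 a = 0].
Proof.
move=> a0; pose A := fun x => h12 x - 2 * h13 x + h33 x.
have Ai : integrable_on A.
  move: (combination_integrable 1 0 (- 2) 1 0).
  by apply: eq_integrable => // x _ /=; congr (_%:E); rewrite /A; ring.
pose k := fun i => 2 * out_frame T a i.
have ei g := @exp_integrable g k.
(* The points 0, 1 and 16 / 25 are squares of sines of angles with rational cosine
   and sine. *)
have [|||H1 H2 H3] := @quadratic_form_line_eq0 _ (axis_sum A a) (2 * axis_sum h66 a)
    (4 * axis_sum h44 a) (a i2 ^+ 2) (a i0 ^+ 2 + a i1 ^+ 2).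
- by rewrite ltr_pwDl ?exprn_gt0// sqr_ge0.
- exact: sqr_ge0.
- move=> s sin.
  have [cs [sn [cs1 {sin}->]]] : exists cs sn : R, cs ^+ 2 + sn ^+ 2 = 1 /\ s = sn ^+ 2.
    move: sin; rewrite !inE => /or3P[] /eqP ->.
    + by exists 1, 0; split; ring.
    + by exists 0, 1; split; ring.
    + by exists (3 / 5), (4 / 5); split; field.
  have [b [aabb ab b2]] := null_companion cs1 a0.
  move=> XX YY.
  have XE : a i2 ^+ 2 + b i2 ^+ 2 = XX by rewrite b2.
  have YE : a i0 ^+ 2 + a i1 ^+ 2 + b i0 ^+ 2 + b i1 ^+ 2 = YY.
    rewrite /YY /XX -b2; apply/eqP; rewrite -subr_eq0; apply/eqP.
    transitivity (ip b b - ip a a); last by rewrite aabb subrr.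
    by rewrite /ip !big_ord_recl !big_ord0; ring.
  rewrite -[RHS](gradient_energy_identity aabb ab) XE YE.
  have eA := ei _ Ai.
  have e66 := ei _ (modulus_integrable i0 i1 i0 i1).
  have e44 := ei _ (modulus_integrable i0 i2 i0 i2).
  transitivity (\int[mu3]_(x in Omega) (XX ^+ 2 * (A x * expR (dot k x)) +
      2 * YY ^+ 2 * (h66 x * expR (dot k x)) + 4 * (XX * YY) * (h44 x * expR (dot k x)))).
    rewrite RintegralD//; last 2 first.
    + by apply: integrable_add => //; exact: integrable_scale.
    + exact: integrable_scale.
    rewrite RintegralD//; try exact: integrable_scale.
    rewrite !RintegralZl// /axis_sum /A /k; ring.
  by apply: eq_Rintegral => x _; rewrite /A /k; ring.
- by split=> //; lra.
Qed.

Lemma reduced_moduli : {ae mu3, forall x : mspace3 R, Omega x ->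
  [/\ h66 x = 0, h44 x = 0 & h33 x = 2 * h13 x - h12 x]}.
Proof.
have Ai : integrable_on (fun x => h12 x - 2 * h13 x + h33 x).
  move: (combination_integrable 1 0 (- 2) 1 0).
  by apply: eq_integrable => // x _ /=; congr (_%:E); ring.
have zA := laplace_injective_frame Ai (fun a a0 => let: And3 z _ _ := transverse_moduli_eq0 a0 in z).
have z66 := laplace_injective_frame (modulus_integrable i0 i1 i0 i1)
  (fun a a0 => let: And3 _ z _ := transverse_moduli_eq0 a0 in z).
have z44 := laplace_injective_frame (modulus_integrable i0 i2 i0 i2)
  (fun a a0 => let: And3 _ _ z := transverse_moduli_eq0 a0 in z).
apply: filterS3 zA z66 z44 => x hA h6 h4 Ox.
by split; [exact: h6|exact: h4|have := hA Ox; lra].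
Qed.

Section divergence.
Variables a b : 'I_3 -> R.
Hypotheses (aabb : ip a a = ip b b) (ab0 : ip a b = 0).
Let a' := out_frame T a.
Let b' := out_frame T b.
Let aabb' : ip a' a' = ip b' b'. Proof. by rewrite !ip_out_frame. Qed.
Let ab0' : ip a' b' = 0. Proof. by rewrite ip_out_frame. Qed.
Let d := fun i => T i i2.
Let X := a i2 ^+ 2 + b i2 ^+ 2.
Let papk := papkovich_field a' b' d lambda mu.
Let grad := gradient_field a' b' d.

Let lame_papk p q : lame_field lambda mu (papk p q).
Proof. exact: lame_papkovich_field. Qed.

Let lame_grad p q : lame_field lambda mu (grad p q).
Proof. exact: lame_gradient_field. Qed.

Let ip_d (u : 'I_3 -> R) : ip (out_frame T u) d = u i2.
Proof. by rewrite -[RHS](out_frameK TT); apply: eq_bigr => i _; rewrite mulrC. Qed.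

Let trace M : R := M i0 i0 + M i1 i1 + M i2 i2.

Let trace_grad p q x : trace (pullback T (jacobian (grad p q) x)) = 0.
Proof.
rewrite /trace (pullback_trace TT) -[RHS](wave0 a' b' d x).
exact: div_gradient_field.
Qed.

Let axial_grad p q x : pullback T (jacobian (grad p q) x) i2 i2 =
  null_dyad a b (expR (dot a' x) * (p * cos (dot b' x) + q * sin (dot b' x)))
                (expR (dot a' x) * (q * cos (dot b' x) - p * sin (dot b' x))) i2 i2.
Proof. exact: (congr1 (fun M : 'I_3 -> 'I_3 -> R => M i2 i2) (pullback_gradient a b p q x)). Qed.

Let trace_papk p q x : trace (pullback T (jacobian (papk p q) x)) = 2 * mu * expR (dot a' x) *
    ((a i2 * p + b i2 * q) * cos (dot b' x) + (a i2 * q - b i2 * p) * sin (dot b' x)).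
Proof.
rewrite /trace (pullback_trace TT).
refine (etrans (div_papkovich_field d aabb' ab0' lambda mu p q x) _).
by rewrite /wave !ip_d; ring.
Qed.

Let reduced_energy : {ae mu3, forall x : mspace3 R, Omega x -> forall U V,
  energy U V x = double_contraction (TI_tensor (h12 x) 0 (h13 x) (2 * h13 x - h12 x) 0)
    (pullback T (jacobian U x)) (pullback T (jacobian V x))}.
Proof.
apply: filterS2 energy_frame reduced_moduli => x h1 h2 Ox U V.
by rewrite h1// /frame_tensor; have [-> -> ->] := h2 Ox.
Qed.

Let reduced_contraction g1 g2 M N D D' s' : trace M = D -> trace N = D' -> N i2 i2 = s' ->
  double_contraction (TI_tensor g1 0 g2 (2 * g2 - g1) 0) M N =
  (g2 - g1) * (D * s' + M i2 i2 * D') + g1 * (D * D').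
Proof. by move=> <- <- <-; exact: double_contraction_trace. Qed.

(** The gradient has no divergence, so only the product of the divergence of the
    first field with the axial entry of the second remains.  The divergence is
    [z_3] times an exponential and the axial entry is [z_3 ^ 2] times one; the
    coefficients [a i2] and [- b i2] supply the missing factor that makes their
    product [|z_3| ^ 4]. *)
Lemma papkovich_gradient_identity :
  \int[mu3]_(x in Omega) (2 * mu * X ^+ 2 * (h13 x - h12 x) *
     expR (dot (fun i => 2 * a' i) x)) = 0.
Proof.
apply: (energy_identity (lame_papk (a i2) (- b i2)) (lame_grad 1 0)
   (lame_papk (b i2) (a i2)) (lame_grad 0 1)).
  apply: exp_integrable; move: (combination_integrable (- (2 * mu * X ^+ 2)) 0 (2 * mu * X ^+ 2) 0 0).
  by apply: eq_integrable => // x _ /=; congr (_%:E); ring.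
apply: filterS reduced_energy => x h Ox.
have E p q p' q' := etrans (h Ox (papk p q) (grad p' q'))
  (reduced_contraction _ _ (trace_papk p q x) (trace_grad p' q' x) (axial_grad p' q' x)).
refine (etrans (congr2 +%R (E _ _ _ _) (E _ _ _ _)) _).
rewrite !mulr0 !addr0 /null_dyad -expR_double.
rewrite -[RHS]mulr1 -[X in _ = _ * X](cos2Dsin2 (dot b' x)) /X; ring.
Qed.

Lemma papkovich_papkovich_identity : {ae mu3, forall x : mspace3 R, Omega x -> h13 x = h12 x} ->
  \int[mu3]_(x in Omega) (4 * mu ^+ 2 * X * h12 x * expR (dot (fun i => 2 * a' i) x)) = 0.
Proof.
move=> h1312.
apply: (energy_identity (lame_papk 1 0) (lame_papk 1 0) (lame_papk 0 1) (lame_papk 0 1)).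
  apply: exp_integrable; move: (combination_integrable (4 * mu ^+ 2 * X) 0 0 0 0).
  by apply: eq_integrable => // x _ /=; congr (_%:E); ring.
apply: filterS2 reduced_energy h1312 => x h hx Ox.
have E p q := etrans (h Ox (papk p q) (papk p q))
  (reduced_contraction _ _ (trace_papk p q x) (trace_papk p q x) erefl).
refine (etrans (congr2 +%R (E _ _) (E _ _)) _).
rewrite hx// subrr !mul0r !add0r -expR_double.
rewrite -[RHS]mulr1 -[X in _ = _ * X](cos2Dsin2 (dot b' x)) /X; ring.
Qed.
End divergence.

Lemma moduli_eq0 : {ae mu3, forall x : mspace3 R, Omega x ->
  forall p q r s, modulus p q r s x = 0}.
Proof.
have comp (a : 'I_3 -> R) : 0 < a i0 -> exists b, [/\ ip a a = ip b b, ip a b = 0 &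
    a i2 ^+ 2 + b i2 ^+ 2 != 0].
  move=> a0; have [|b [h1 h2 h3]] := @null_companion a 0 1 _ a0; first by ring.
  exists b; split=> //; rewrite h3 expr1n mul1r gt_eqF//.
  by rewrite ltr_wpDl ?sqr_ge0// ltr_pwDl ?exprn_gt0// sqr_ge0.
have muN0 : mu != 0 by rewrite gt_eqF.
have zB : {ae mu3, forall x : mspace3 R, Omega x -> h13 x - h12 x = 0}.
  have Bi : integrable_on (fun x => h13 x - h12 x).
    move: (combination_integrable (-1) 0 1 0 0).
    by apply: eq_integrable => // x _ /=; congr (_%:E); ring.
  apply: laplace_injective_frame => // a /comp[b [h1 h2 h3]].
  have cN0 : 2 * mu * (a i2 ^+ 2 + b i2 ^+ 2) ^+ 2 != 0.
    by rewrite !mulf_neq0// ?expf_neq0// pnatr_eq0.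
  apply: (mulfI cN0); rewrite mulr0 -[RHS](papkovich_gradient_identity h1 h2).
  rewrite -RintegralZl//; last exact: exp_integrable.
  by apply: eq_Rintegral => x _; rewrite mulrA.
have z1312 : {ae mu3, forall x : mspace3 R, Omega x -> h13 x = h12 x}.
  by apply: filterS zB => x h Ox; apply/eqP; rewrite -subr_eq0 h.
have z12 : {ae mu3, forall x : mspace3 R, Omega x -> h12 x = 0}.
  apply: laplace_injective_frame; first exact: modulus_integrable.
  move=> a /comp[b [h1 h2 h3]].
  have cN0 : 4 * mu ^+ 2 * (a i2 ^+ 2 + b i2 ^+ 2) != 0.
    by rewrite !mulf_neq0// ?expf_neq0// pnatr_eq0.
  apply: (mulfI cN0); rewrite mulr0 -[RHS](papkovich_papkovich_identity h1 h2 z1312).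
  rewrite -RintegralZl//; last by apply: exp_integrable; exact: modulus_integrable.
  by apply: eq_Rintegral => x _; rewrite mulrA.
have z : {ae mu3, forall x : mspace3 R, Omega x -> h13 x = h12 x /\ h12 x = 0}.
  by apply: filterS2 z1312 z12 => x h2 h3 Ox; split; [exact: h2|exact: h3].
apply: filterS3 dC_frame reduced_moduli z => x hc h1 h Ox p q r s.
have [h2 h3] := h Ox.
rewrite hc// /frame_tensor; have [-> -> ->] := h1 Ox; rewrite h2 h3.
by rewrite /TI_tensor; ring.
Qed.

Lemma perturbation_eq0 : {ae mu3, forall x : mspace3 R, Omega x ->
  forall i j k l, dC i j k l x = 0}.
Proof.
apply: filterS moduli_eq0 => x h Ox i j k l.
rewrite -[LHS](rotateK (dC_at x) TT) /rotate.
by do 4 (rewrite big1// => ? _); rewrite [X in _ * X]h// mulr0.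
Qed.
End inverse_problem.

Theorem theorem1 (R : realType) (Omega : set (space3 R)) (e : 'cV[R]_3)
    (lambda mu : R) (dC : tensor_field R) (L : vfield R -> vfield R -> R[i])
    (Omega_open : open Omega) (Omega_bounded : bounded_set Omega)
    (Omega_connected : connected Omega) (Omega_C11 : C11_boundary Omega)
    (e_unit : \sum_i e i 0 ^+ 2 = 1)
    (mu_gt0 : 0 < mu) (lambda_mu_gt0 : 0 < 3 * lambda + 2 * mu)
    (dC_elastic : elastic_perturbation Omega dC)
    (dC_TI : transversely_isotropic Omega e dC)
    (L_DtN : linearized_DtN Omega lambda mu dC L)
    (L_eq0 : forall f g, H12 Omega f -> H12 Omega g -> L f g = 0) :
  {ae @lebesgue3 R, forall x, Omega x -> forall i j k l, dC i j k l x = 0}.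
Proof.
have [dC_bounded dC_sym] := dC_elastic; have [T [TT _ _ TI]] := dC_TI.
apply: (perturbation_eq0 Omega_open Omega_bounded mu_gt0 TT _ L_DtN L_eq0).
  by move=> i j k l; exact: Linfty_integrable.
apply: (ae_apply2 _ dC_sym TI) => x sym inv Ox p q r s.
apply: (frame_TI_tensor TT) => [i j k l|i j k l|].
- by have [] := sym Ox i j k l.
- by have [] := sym Ox i j k l.
- exact: inv.
Qed.
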